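(* Let $\mathbf G$ be a compact metric graph without cycles. Let $v_\infty$ be a minimizer of $S_\infty^N(\mathbf G)$, and let $x_+,x_-\in\mathbf G$ satisfy $v_\infty(x_+)=1$ and $v_\infty(x_-)=-1$. Then $$\operatorname{dist}(x_-,x_+)=\max_{x,y\in\mathbf G}\operatorname{dist}(x,y).$$ Moreover, if $\mathbf U$ denotes the unique path joining $x_-$ and $x_+$, then $$v_\infty(x)=-1+\frac{2\operatorname{dist}(x_-,x)}{\operatorname{dist}(x_-,x_+)},\qquad x\in\mathbf U,$$ and $v_\infty$ is constant on each connected component of $\mathbf G\setminus\mathbf U$.
   Context: $\mathbf G=\mathbf G(\mathbf V,\mathbf E)$ is a graph with vertex set $\mathbf V$ and edge set $\mathbf E$; it is connected, has finitely many edges, contains no loops, and no vertex has degree $2$. It is a compact metric graph: each edge $\mathbf e$ is identified with an interval $[0,l(\mathbf e)]$ with $0<l(\mathbf e)<\infty$. $\operatorname{dist}$ is the shortest-path distance on $\mathbf G$. A cycle is a closed path consisting of distinct edges and vertices, except for its initial and terminal vertex, which coincide. $H^1(\mathbf G)$ is the space of continuous $u$ on $\mathbf G$ whose restriction to each edge $\mathbf e$ lies in $H^1(\mathbf e)$; $\nabla=\frac{d}{dx}$ on each edge, $\int_{\mathbf G}=\sum_{\mathbf e}\int_0^{l(\mathbf e)}$. $$S_\infty^N(\mathbf G)=\inf\Big\{\int_{\mathbf G}|\nabla u|^2dx:\ u\in H^1(\mathbf G),\ \max_{\mathbf G}u=1,\ \min_{\mathbf G}u=-1\Big\};$$ a minimizer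 of $S_\infty^N(\mathbf G)$ is an admissible function attaining this infimum. *)

(* Defs.v *)
From HB Require Import structures.
From mathcomp Require Import all_boot all_order all_algebra.
From mathcomp Require Import all_classical all_reals all_analysis.
From mathcomp Require Import lra.

Set Implicit Arguments.
Unset Strict Implicit.
Unset Printing Implicit Defensive.

Import Order.TTheory GRing.Theory Num.Theory.
Import numFieldNormedType.Exports.

Local Open Scope classical_set_scope.
Local Open Scope ring_scope.

Definition is_max (R : realType) (A : set R) (m : R) : Prop := A m /\ ubound A m.
Definition is_min (R : realType) (A : set R) (m : R) : Prop := A m /\ lbound A m.

Definition ends_at (V E : finType) (src tgt : E -> V) (e : E) (v w : V) : bool :=
  ((src e == v) && (tgt e == w)) || ((src e == w) && (tgt e == v)).

(* The edge [e] is the interval [0, len e], with 0 at [src e] and [len e] at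
   [tgt e]; this orientation is only a choice of parametrization.  Several
   edges may have the same endpoints.  A connected graph with finitely many
   edges has finitely many vertices, so [vert] is a finite type. *)
Record metricGraph (R : realType) := MetricGraph {
  vert : finType;
  edge : finType;
  src : edge -> vert;
  tgt : edge -> vert;
  len : edge -> R;
  len_gt0 : forall e, 0 < len e;
  no_loop : forall e, src e != tgt e;
  graph_connected :
    forall v w, connect [rel a b | [exists e, ends_at src tgt e a b]] v w;
  degree_neq2 :
    forall v, #|[set e | (src e == v) || (tgt e == v)]%SET| <> 2%N
}.

(* A walk from [v] is the list of its steps: an edge and the vertex it leads
   to. *)
Fixpoint walk (R : realType) (G : metricGraph R) (v : vert G)
    (p : seq (edge G * vert G)) : bool :=
  if p is (e, w) :: p' then ends_at (@src R G) (@tgt R G) e v w && walk w p'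
  else true.

Definition is_cycle (R : realType) (G : metricGraph R) (v : vert G)
    (p : seq (edge G * vert G)) : Prop :=
  [/\ p != [::], walk v p, last v (unzip2 p) = v,
      uniq (unzip1 p) & uniq (unzip2 p)].

Definition acyclic (R : realType) (G : metricGraph R) : Prop :=
  forall (v : vert G) p, ~ is_cycle v p.

(* The points of the metric graph: its vertices, and the interior points of
   its edges. *)
Definition gpoint (R : realType) (G : metricGraph R) : Type :=
  (vert G + {z : edge G * R | 0 < z.2 < len z.1})%type.

HB.instance Definition _ (R : realType) (G : metricGraph R) :=
  Choice.copy (gpoint G) (vert G + {z : edge G * R | (0 < z.2 < len z.1)%R})%type.

(* The point of [e] at coordinate [t], for 0 <= t <= len e; outside this
   interval [t] is clamped. *)
Definition pt (R : realType) (G : metricGraph R) (e : edge G) (t : R) : gpoint G :=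
  if insub (e, t) is Some z then inr z
  else if t <= 0 then inl (src e) else inl (tgt e).

(* [route x L y]: a path of length [L], made of finitely many segments each
   contained in an edge, leads from [x] to [y]. *)
Inductive route (R : realType) (G : metricGraph R) :
    gpoint G -> R -> gpoint G -> Prop :=
| route_nil x : route x 0 x
| route_cons (e : edge G) (s t L : R) (y : gpoint G) :
    0 <= s <= len e -> 0 <= t <= len e ->
    route (pt e t) L y -> route (pt e s) (`|s - t| + L) y.

Definition dist (R : realType) (G : metricGraph R) (x y : gpoint G) : R :=
  inf [set L | route x L y].

Section dist_metric.
Context {R : realType} {G : metricGraph R}.
Implicit Types (x y z : gpoint G) (e : edge G) (L : R).

Let z0 e : 0 <= (0 : R) <= len e.
Proof. by rewrite lexx ltW ?len_gt0. Qed.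

Let zl e : 0 <= len e <= len e.
Proof. by rewrite lexx ltW ?len_gt0. Qed.

Lemma pt_src e : pt e 0 = inl (src e).
Proof. by rewrite /pt insubF ?lexx//= ltxx. Qed.

Lemma pt_tgt e : pt e (len e) = inl (tgt e).
Proof. by rewrite /pt insubF /= ?ltxx ?andbF// leNgt len_gt0. Qed.

Lemma pt_inr (q : {z : edge G * R | 0 < z.2 < len z.1}) :
  pt (val q).1 (val q).2 = inr q.
Proof. by rewrite /pt -surjective_pairing valK. Qed.

Lemma pt_case e s : 0 <= s <= len e ->
  [\/ s = 0, s = len e |
   exists2 q : {z : edge G * R | 0 < z.2 < len z.1},
     val q = (e, s) & pt e s = inr q].
Proof.
move=> /andP[s0 sl].
have [/eqP|sn0] := boolP (s == 0); first by constructor 1.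
have [/eqP|snl] := boolP (s == len e); first by constructor 2.
have {}s0 : 0 < s by rewrite lt_neqAle eq_sym sn0.
have {}sl : s < len e by rewrite lt_neqAle snl.
have h : 0 < (e, s).2 < len (e, s).1 by rewrite /= s0.
by constructor 3; exists (exist _ (e, s) h) => //; rewrite -pt_inr.
Qed.

Lemma route_ge0 x L y : route x L y -> 0 <= L.
Proof. by elim=> // e s t L' y' _ _ _ L0; rewrite addr_ge0. Qed.

Lemma route_cat x y z L1 L2 :
  route x L1 y -> route y L2 z -> route x (L1 + L2) z.
Proof.
move=> r; elim: r z L2 => [x' z L2|e s t L y' hs ht _ IH z L2 h].
  by rewrite add0r.
by rewrite -addrA; apply: route_cons => //; exact: IH.
Qed.

Lemma route_seg e s t : 0 <= s <= len e -> 0 <= t <= len e ->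
  route (pt e s) `|s - t| (pt e t).
Proof.
move=> hs ht; rewrite -[X in route _ X _]addr0.
by apply: route_cons => //; exact: route_nil.
Qed.

Lemma route_sym x L y : route x L y -> route y L x.
Proof.
elim=> [x'|e s t L' y' hs ht _ IH]; first exact: route_nil.
by rewrite addrC; apply: (route_cat IH); rewrite distrC; exact: route_seg.
Qed.

Lemma route_vert (v w : vert G) : exists L, @route R G (inl v) L (inl w).
Proof.
have /connectP[p] := graph_connected v w.
elim: p v => [|a p IH] v /=; first by move=> _ ->; exists 0; exact: route_nil.
move=> /andP[/existsP[e he] /IH{}IH] /IH[L r].
suff [L' r'] : exists L', @route R G (inl v) L' (inl a).
  by exists (L' + L); exact: route_cat r' r.
have rr : @route R G (inl (src e)) `|0 - len e| (inl (tgt e)).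
  by rewrite -pt_src -pt_tgt; exact: route_seg.
exists `|0 - len e|; case/orP: he => /andP[/eqP h1 /eqP h2].
  by rewrite -h1 -h2.
by rewrite -h1 -h2; exact: route_sym.
Qed.

Lemma route_from_vert x : exists v L, @route R G (inl v) L x.
Proof.
case: x => [v|q]; first by exists v, 0; exact: route_nil.
rewrite -pt_inr; case: q => -[e t] /= /andP[t0 tl].
exists (src e), `|0 - t|; rewrite -pt_src; apply: route_seg => //.
by rewrite !ltW.
Qed.

Lemma route_exists x y : exists L, route x L y.
Proof.
have [v [L1 r1]] := route_from_vert x.
have [w [L2 r2]] := route_from_vert y.
have [L r] := route_vert v w.
by exists (L1 + (L + L2)); apply: route_cat (route_sym r1) (route_cat r r2).
Qed.

Lemma has_inf_route x y : has_inf [set L | route x L y].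
Proof.
split; first exact: route_exists.
by exists 0 => L /route_ge0.
Qed.

Lemma distxx x : dist x x = 0.
Proof.
apply/eqP; rewrite eq_le; apply/andP; split.
  by apply: ge_inf => /=; [exact: (has_inf_route x x).2|exact: route_nil].
by apply: lb_le_inf; [exact: route_exists|move=> L /route_ge0].
Qed.

Lemma dist_sym x y : dist x y = dist y x.
Proof. by congr inf; apply/seteqP; split => L /route_sym. Qed.

Lemma dist_triangle y x z : dist x z <= dist x y + dist y z.
Proof.
rewrite -lerBlDr; apply: lb_le_inf; first exact: route_exists.
move=> L1 r1; rewrite lerBlDr -lerBlDl; apply: lb_le_inf.
  exact: route_exists.
move=> L2 r2; rewrite lerBlDl; apply: ge_inf; first exact: (has_inf_route x z).2.
exact: route_cat r1 r2.
Qed.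

Lemma lipschitz_le_dist (f : gpoint G -> R) :
  (forall e s t, 0 <= s <= len e -> 0 <= t <= len e ->
     `|f (pt e s) - f (pt e t)| <= `|s - t|) ->
  forall x y, `|f x - f y| <= dist x y.
Proof.
move=> lf x y; apply: lb_le_inf; first exact: route_exists.
move=> L; elim=> [x'|e s t L' y' hs ht _ IH]; first by rewrite subrr normr0.
rewrite (le_trans (ler_distD (f (pt e t)) _ _))//.
by apply: lerD => //; exact: lf.
Qed.

Let tent (a d s : R) := Num.max 0 (d - `|s - a|).

Let tent_lipschitz a d s t : `|tent a d s - tent a d t| <= `|s - t|.
Proof.
have h : `|(`|s - a| - `|t - a|)| <= `|s - t|.
  by rewrite (le_trans (ler_dist_dist _ _))// opprB addrA subrK.
rewrite /tent; move: h; move: `|s - a| `|t - a| `|s - t| => A B C.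
rewrite ler_norml => /andP[h1 h2].
by rewrite ler_norml; case: (ltP 0 (d - A)); case: (ltP 0 (d - B));
  move=> *; apply/andP; split; lra.
Qed.

Let bump (e : edge G) (a d : R) x : R :=
  if x is inr q then if (val q).1 == e then tent a d (val q).2 else 0 else 0.

Let dist_inr_gt0 q x : x != inr q -> 0 < dist (inr q) x.
Proof.
move: q => -[[e a] /= ea] xq.
have /andP[a0 al] := ea.
pose d := Num.min a (len e - a).
have d0 : 0 < d by rewrite lt_min a0 subr_gt0.
have da : d <= a by rewrite ge_min lexx.
have dl : d <= len e - a by rewrite ge_min lexx orbT.
have bE e' s : 0 <= s <= len e' ->
    bump e a d (pt e' s) = if e' == e then tent a d s else 0.
  move=> /pt_case[->|->|[q qE ->]].
  - rewrite pt_src /=; case: eqP => // _.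
    by rewrite /tent sub0r normrN gtr0_norm//; apply/esym/max_idPl; lra.
  - rewrite pt_tgt /=; case: eqP => // ->.
    by rewrite /tent ger0_norm; [apply/esym/max_idPl; lra|lra].
  - by rewrite /= qE.
apply: (@lt_le_trans _ _ `|bump e a d (inr (exist _ (e, a) ea)) - bump e a d x|);
  last first.
  apply: lipschitz_le_dist => e' s t hs ht; rewrite !bE//.
  by case: eqP => _; [exact: tent_lipschitz|rewrite subrr normr0].
rewrite normr_gt0 subr_eq0 /= eqxx {1}/tent subrr normr0 subr0.
rewrite (_ : Num.max 0 d = d); last by apply/max_idPr; exact: ltW.
case: x xq => [v _|[[e' t] /= h]]; first by rewrite gt_eqF.
rewrite /=; have [ee|_ _] := eqVneq e' e; last by rewrite gt_eqF.
subst e' => xq; have : t != a.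
  apply: contra xq => /eqP ta; apply/eqP; congr inr; apply/val_inj.
  by rewrite /= ta; congr pair.
rewrite /tent => ta; have {}ta : 0 < `|t - a| by rewrite normr_gt0 subr_eq0.
by rewrite gt_eqF// gt_max d0/= ltrBlDr ltrDl.
Qed.

Let star (v : vert G) (d : R) x : R :=
  match x with
  | inl w => if w == v then d else 0
  | inr q => if src (val q).1 == v then tent 0 d (val q).2
             else if tgt (val q).1 == v then tent (len (val q).1) d (val q).2
             else 0
  end.

Let dist_inl_gt0 (v w : vert G) : w != v -> 0 < @dist R G (inl v) (inl w).
Proof.
move=> wv; pose d := \big[Num.min/(1 : R)]_(e : edge G) len e.
have d0 : 0 < d.
  by rewrite /d; elim/big_ind: _ => // [a b a0 b0|e _];
    [rewrite lt_min a0 b0|exact: len_gt0].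
have dl (e : edge G) : d <= len e by rewrite /d (bigD1 e)//= ge_min lexx.
have sE e s : 0 <= s <= len e -> star v d (pt e s) =
    if src e == v then tent 0 d s
    else if tgt e == v then tent (len e) d s else 0.
  have nl := no_loop e; have lg := dl e; have l0 := len_gt0 e.
  move=> /pt_case[->|->|[q qE ->]].
  - rewrite pt_src /=; case: eqP => [_|_].
      by rewrite /tent subrr normr0 subr0; apply/esym/max_idPr; exact: ltW.
    case: eqP => // _; rewrite /tent sub0r normrN gtr0_norm//.
    by apply/esym/max_idPl; lra.
  - rewrite pt_tgt /=; have [sv|_] := eqVneq (src e) v.
      rewrite -sv eq_sym (negPf nl) /tent subr0 gtr0_norm//.
      by apply/esym/max_idPl; lra.
    case: eqP => // _; rewrite /tent subrr normr0 subr0.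
    by apply/esym/max_idPr; exact: ltW.
  - by rewrite /= qE.
apply: (@lt_le_trans _ _ `|star v d (inl v) - star v d (inl w)|); last first.
  apply: lipschitz_le_dist => e s t hs ht; rewrite !sE//.
  by do 2 ?case: ifP => _; rewrite ?tent_lipschitz// subrr normr0.
by rewrite /= eqxx (negPf wv) subr0 normr_gt0 gt_eqF.
Qed.

Lemma dist_eq0 x y : dist x y = 0 -> x = y.
Proof.
move=> xy0; apply/eqP; apply/negPn/negP => xy.
suff : 0 < dist x y by rewrite xy0 ltxx.
case: x xy {xy0} => [v|q]; last by rewrite eq_sym; exact: dist_inr_gt0.
case: y => [w|q] xy; last by rewrite dist_sym; exact: dist_inr_gt0.
by apply: dist_inl_gt0; apply: contra xy => /eqP ->.
Qed.

End dist_metric.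

HB.instance Definition _ (R : realType) (G : metricGraph R) :=
  isMetric.Build R (gpoint G) (@distxx R G) (@dist_eq0 R G) (@dist_sym R G)
    (@dist_triangle R G).

(* [g] is the weak derivative of [f] on ]0, l[ and lies in L^2(0, l).  The test
   functions are those of class C^1 with compact support in ]0, l[, as in
   Brezis' definition of the Sobolev spaces on an interval. *)
Definition weak_derivative (R : realType) (l : R) (f g : R -> R) : Prop :=
  g \_ `]0, l[ \in Lfun lebesgue_measure 2%:E /\
  forall phi : R -> R,
    (forall t, derivable phi t 1) -> continuous (derive1 phi) ->
    closure [set t | phi t != 0] `<=` `]0, l[ ->
    \int[lebesgue_measure]_(t in `]0, l[) (f t * derive1 phi t) =
    - \int[lebesgue_measure]_(t in `]0, l[) (g t * phi t).

Definition H1_interval (R : realType) (l : R) (f : R -> R) : Prop :=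
  f \_ `]0, l[ \in Lfun lebesgue_measure 2%:E /\
  exists g, weak_derivative l f g.

(* the weak derivative of [f], determined almost everywhere when [f] is in
   H^1(0, l) *)
Definition grad (R : realType) (l : R) (f : R -> R) : R -> R :=
  xget (fun=> 0) [set g | weak_derivative l f g].

Definition H1 (R : realType) (G : metricGraph R) (u : gpoint G -> R) : Prop :=
  continuous u /\ forall e, H1_interval (len e) (fun t => u (pt e t)).

Definition energy (R : realType) (G : metricGraph R) (u : gpoint G -> R) : \bar R :=
  (\sum_(e : edge G) \int[lebesgue_measure]_(t in `]0%R, len e[)
     ((grad (len e) (fun s => u (pt e s)) t) ^+ 2)%:E)%E.

Definition admissible (R : realType) (G : metricGraph R) (u : gpoint G -> R) : Prop :=
  [/\ H1 u, is_max (range u) 1 & is_min (range u) (- 1)].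

(* +oo when [G] is a single vertex, for lack of admissible functions *)
Definition S_inftyN (R : realType) (G : metricGraph R) : \bar R :=
  ereal_inf [set energy u | u in [set u : gpoint G -> R | admissible u]].

Definition minimizer (R : realType) (G : metricGraph R) (u : gpoint G -> R) : Prop :=
  admissible u /\ energy u = S_inftyN G.

(* [U] is the trace of a simple path from [x] to [y]. *)
Definition simple_path (R : realType) (G : metricGraph R) (x y : gpoint G)
    (U : set (gpoint G)) : Prop :=
  exists gamma : R -> gpoint G,
    [/\ {within `[0, 1], continuous gamma}, set_inj `[0, 1] gamma,
        gamma 0 = x, gamma 1 = y & U = gamma @` `[0, 1]].

(* Main.v *)
Require Import Defs.
From mathcomp Require Import all_boot all_order all_algebra.
From mathcomp Require Import all_classical all_reals all_analysis.
From mathcomp Require Import measurable_realfun ring lra.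

Set Implicit Arguments.
Unset Strict Implicit.
Unset Printing Implicit Defensive.

Import Order.TTheory GRing.Theory Num.Theory.
Import numFieldNormedType.Exports.

(** Why the theorem holds.

    In a tree, removing an edge [e] separates the vertices into two sides, so
    every point [z] has a nearest point on [e], with coordinate [foot e z].
    These coordinates embed the tree isometrically in an l^1 space:
    [dist x y] is the sum over [e] of [`|foot e x - foot e y|] ([dist_foot]).
    Moreover a point moving inside an edge changes its foot on that edge only,
    whence the discrete fundamental theorem of calculus [telescope]: for every
    function [u], the increment [u y - u x] is the sum over the edges of the
    increments of [u] between the feet of [x] and [y].

    Given [x <> y], let [w z = (dist x z - dist y z) / dist x y]
    ([potential x y]).  On an edge [e] its slope is [2 / dist x y], up to the
    sign, between the feet of [x] and [y], and 0 elsewhere.  Therefore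
    [telescope], together with the fundamental theorem of calculus on each edge
    ([weak_derivative_FTC]), shows that for every [u] in H^1 the integral of
    [u' * w'] is [2 / dist x y * (u y - u x)] ([potential_pairing]).  With
    [u = w], the energy of [w] is [4 / dist x y].  If [v x = - 1] and
    [v y = 1], then [v' - w'] is orthogonal to [w'], so that the energy of [v]
    exceeds that of [w] by the integral of [(v' - w')^2]: a function whose
    energy is at most [4 / dist x y] is equal to [w] ([le_energy_potential]).

    A minimizer is thus the potential of any two points where it takes the
    values -1 and 1, and has energy [4 / dist xm xp].  Comparing with the
    potentials of all other pairs of points shows that [dist xm xp] is the
    diameter.  On the segment from [xm] to [xp] the potential is the affine
    function of [dist xm] of the theorem.

    What remains is the topology of trees.  Geodesic triangles are thin
    ([seg_thin]); hence being beyond a point [p] as seen from [x] is a locally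
    constant property off [p], and a connected set contains the segment between
    any two of its points ([connected_seg]).  This identifies the simple paths
    ([simple_path_unique]) and makes the potential constant on the components
    of the complement of the segment ([off_seg_constant]). *)

Local Open Scope classical_set_scope.
Local Open Scope ring_scope.

(** * The cuts of a tree and its l^1 coordinates *)

Section cuts.
Context {R : realType} {G : metricGraph R}.
Implicit Types (e f : edge G) (v w : vert G) (x y z p : gpoint G).

Definition adj_off e : rel (vert G) :=
  [rel a b | [exists f, (f != e) && ends_at (@src R G) (@tgt R G) f a b]].

Definition on_tgt_side e v : bool := connect (adj_off e) (tgt e) v.

Lemma ends_at_sym f v w :
  ends_at (@src R G) (@tgt R G) f v w = ends_at (@src R G) (@tgt R G) f w v.
Proof. by rewrite /ends_at orbC. Qed.

Lemma adj_off_sym e : connect_sym (adj_off e).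
Proof.
by apply: sym_connect_sym => a b /=; apply: eq_existsb => f; rewrite ends_at_sym.
Qed.

Lemma on_tgt_sideF e f : f != e -> on_tgt_side e (src f) = on_tgt_side e (tgt f).
Proof.
move=> fe; apply: (same_connect1r (@adj_off_sym e)) => /=.
by apply/existsP; exists f; rewrite fe /ends_at !eqxx.
Qed.

Lemma walk_ends v q f : walk v q -> f \in unzip1 q ->
  (src f \in v :: unzip2 q) && (tgt f \in v :: unzip2 q).
Proof.
elim: q v => // -[f' w] q IH v /= /andP[vw wq].
rewrite inE => /predU1P[->|/(IH _ wq) /andP[s t]]; last first.
  by rewrite (in_cons v) s (in_cons v) t !orbT.
by case/orP: vw => /andP[/eqP-> /eqP->]; rewrite !inE !eqxx ?orbT.
Qed.

(** Distinct vertices force distinct edges: an edge used at the first step has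
    the starting vertex as an end, which is never visited again. *)
Lemma path_walk (A : pred (edge G)) v s :
  path [rel a b | [exists f, A f && ends_at (@src R G) (@tgt R G) f a b]] v s ->
  uniq (v :: s) ->
  exists q, [/\ walk v q, unzip2 q = s, uniq (unzip1 q) & all A (unzip1 q)].
Proof.
elim: s v => [|w s IH] v; first by exists [::].
rewrite [path _ _ _]/= => /andP[/existsP[f /andP[Af vw]] ws].
rewrite [uniq _]/= -/(uniq (w :: s)) => /andP[vs us].
have [q [wq qs uq Aq]] := IH _ ws us.
exists ((f, w) :: q); split=> //=; rewrite ?vw ?wq ?qs ?Af ?uq ?Aq// andbT.
apply: contra vs => /(walk_ends wq)/andP; rewrite qs.
by case/orP: vw => /andP[/eqP-> /eqP->] [].
Qed.

Hypothesis G_tree : acyclic G.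

Lemma on_tgt_side_tgt e : on_tgt_side e (tgt e).
Proof. exact: connect0. Qed.

(** Otherwise the edge [e] would close up a path joining its ends off [e]. *)
Lemma on_tgt_side_src e : on_tgt_side e (src e) = false.
Proof.
apply/negP => /connectP[s0 hs0 ls0].
case/shortenP: hs0 ls0 => s hs us _ ls {s0}.
have [q [wq qs uq Aq]] := path_walk (A := predC1 e) hs us.
apply: (@G_tree (src e) ((e, tgt e) :: q)); split=> //=.
- by rewrite wq /ends_at !eqxx.
- by rewrite qs.
- rewrite uq andbT; apply/negP => eq; have /allP/(_ _ eq) := Aq.
  by rewrite /= eqxx.
- by rewrite qs.
Qed.

(** The coordinate on [e] of the point of [e] nearest to the given point. *)
Definition foot e x : R :=
  match x with
  | inl v => if on_tgt_side e v then len e else 0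
  | inr q => if (val q).1 == e then (val q).2
             else if on_tgt_side e (src (val q).1) then len e else 0
  end.

Lemma foot_range e x : 0 <= foot e x <= len e.
Proof.
have l0 := len_gt0 e; case: x => [v|[[f t] /= ft]] /=.
  by case: ifP => _; rewrite ?lexx ltW.
by case: eqP => [<-|_]; [case/andP: ft => *; rewrite !ltW|
   case: ifP => _; rewrite ?lexx ltW].
Qed.

Lemma foot_pt e t : 0 <= t <= len e -> foot e (pt e t) = t.
Proof.
move=> /pt_case[->|->|[q qE ->]].
- by rewrite pt_src /= on_tgt_side_src.
- by rewrite pt_tgt /= on_tgt_side_tgt.
- by rewrite /= qE eqxx.
Qed.

Lemma foot_pt_neq e f t : f != e -> 0 <= t <= len f ->
  foot e (pt f t) = foot e (inl (src f)).
Proof.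
move=> fe /pt_case[->|->|[q qE ->]].
- by rewrite pt_src.
- by rewrite pt_tgt /= on_tgt_sideF.
- by rewrite /= qE /= (negPf fe).
Qed.

Lemma foot_pt_neq2 e f s t : f != e -> 0 <= s <= len f -> 0 <= t <= len f ->
  foot e (pt f s) = foot e (pt f t).
Proof. by move=> fe hs ht; rewrite !foot_pt_neq. Qed.

Definition foot_dist x y : R := \sum_e `|foot e x - foot e y|.

Lemma foot_distC x y : foot_dist x y = foot_dist y x.
Proof. by apply: eq_bigr => e _; rewrite distrC. Qed.

Lemma foot_dist_pt e s t y : 0 <= s <= len e -> 0 <= t <= len e ->
  foot_dist (pt e s) y - foot_dist (pt e t) y =
  `|s - foot e y| - `|t - foot e y|.
Proof.
move=> hs ht; rewrite /foot_dist (bigD1 e)//= [X in _ - X](bigD1 e)//=.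
rewrite !foot_pt// (eq_bigr (fun f => `|foot f (pt e t) - foot f y|)); last first.
  by move=> f fe; rewrite (@foot_pt_neq2 f e s t)// eq_sym.
by rewrite opprD addrACA subrr addr0.
Qed.

Lemma foot_dist_le x y : foot_dist x y <= dist x y.
Proof.
have <- : foot_dist x y - foot_dist y y = foot_dist x y.
  rewrite [X in _ - X]/foot_dist big1 ?subr0// => e _.
  by rewrite subrr normr0.
apply: le_trans (ler_norm _) _.
apply: (@lipschitz_le_dist R G (fun z => foot_dist z y)) => e s t hs ht.
rewrite foot_dist_pt// (le_trans (ler_dist_dist _ _))//.
by rewrite opprB addrA subrK.
Qed.

Lemma walk_foot e v q : walk v q -> e \notin unzip1 q ->
  foot e (inl v) = foot e (inl (last v (unzip2 q))).
Proof.
elim: q v => // -[f w] q IH v /= /andP[vw wq].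
rewrite inE negb_or eq_sym => /andP[fe eq]; rewrite -[RHS]/(foot e (inl _)) -IH//=.
by case/orP: vw => /andP[/eqP<- /eqP<-]; rewrite on_tgt_sideF.
Qed.

(** A walk without repeated edge crosses the cut of each of its edges exactly
    once, and no other cut. *)
Lemma walk_route v q : walk v q -> uniq (unzip1 q) ->
  let w := last v (unzip2 q) in route (inl v) (foot_dist (inl v) (inl w)) (inl w).
Proof.
elim: q v => [|[f w] q IH] v /=.
  move=> _ _; rewrite /foot_dist big1 => [|e _]; first exact: route_nil.
  by rewrite subrr normr0.
move=> /andP[vw wq] /andP[fq uq]; have {}IH := IH _ wq uq.
have [s [t [hs ht -> wE]]] : exists s t, [/\ 0 <= s <= len f, 0 <= t <= len f,
    inl v = pt f s & inl w = pt f t].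
  have lf := ltW (len_gt0 f).
  by case/orP: vw => /andP[/eqP<- /eqP<-]; [exists 0, (len f)|exists (len f), 0];
    rewrite pt_src pt_tgt !lexx lf.
have := walk_foot wq fq; rewrite wE foot_pt// => tE.
have /eqP := @foot_dist_pt f s t (inl (last w (unzip2 q))) hs ht.
rewrite -tE subrr normr0 subr0 subr_eq => /eqP ->.
by apply: route_cons => //; rewrite -wE.
Qed.

Lemma route_vert_foot v w :
  route (inl v) (foot_dist (inl v) (inl w)) (inl w).
Proof.
have /connectP[s0 hs0 ls0] := graph_connected v w.
case/shortenP: hs0 ls0 => s hs us _ ->{s0}.
have [|q [wq qs uq _]] := @path_walk predT v s _ us.
  by rewrite (eq_path (e' := [rel a b |
    [exists f, ends_at (@src R G) (@tgt R G) f a b]])).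
by rewrite -qs; exact: walk_route.
Qed.

(** To leave [e], go first to the foot of the target. *)
Lemma route_pt_foot e s y : 0 <= s <= len e ->
  (let x := pt e (foot e y) in route x (foot_dist x y) y) ->
  route (pt e s) (foot_dist (pt e s) y) y.
Proof.
move=> hs r; have ht := foot_range e y.
have /eqP := foot_dist_pt y hs ht; rewrite subrr normr0 subr0 subr_eq => /eqP ->.
exact: route_cons.
Qed.

Lemma foot_vert e v : foot e (inl v) = 0 \/ foot e (inl v) = len e.
Proof. by rewrite /=; case: ifP; [right|left]. Qed.

Lemma pt_foot_vert e v : exists w, pt e (foot e (inl v)) = inl w.
Proof.
by case: (foot_vert e v) => ->; [rewrite pt_src; exists (src e)|
  rewrite pt_tgt; exists (tgt e)].
Qed.

(** Points inside edges are first brought to the vertices: by [route_pt_foot]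
    one may replace each end by its foot on the edge of this end, which is a
    vertex unless both ends are on the same edge. *)
Lemma route_foot x y : route x (foot_dist x y) y.
Proof.
have vx v z : route (inl v) (foot_dist (inl v) z) z.
  case: z => [w|q]; first exact: route_vert_foot.
  rewrite foot_distC; apply: route_sym; rewrite -pt_inr.
  apply: route_pt_foot; first by case: q => -[e t] /= /andP[? ?]; rewrite !ltW.
  by have [w ->] := pt_foot_vert (val q).1 v; exact: route_vert_foot.
case: x => [v|q]; first exact: vx.
rewrite -pt_inr; apply: route_pt_foot.
  by case: q => -[e t] /= /andP[? ?]; rewrite !ltW.
case: y => [w|q'].
  by have [v ->] := pt_foot_vert (val q).1 w; exact: vx.
have [qq|qq] := eqVneq (val q').1 (val q).1.
  rewrite /= /foot qq eqxx -qq pt_inr /foot_dist big1 => [|e _].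
    exact: route_nil.
  by rewrite subrr normr0.
have [v ->] : exists v, pt (val q).1 (foot (val q).1 (inr q')) = inl v.
  rewrite /foot (negPf qq); case: ifP => _.
    by rewrite pt_tgt; exists (tgt (val q).1).
  by rewrite pt_src; exists (src (val q).1).
exact: vx.
Qed.

(** Along a route only the foot on the current edge moves, which bounds the sum
    by the length of the route; the walks without repeated edge attain it.  The
    tree is thus isometric to a part of an l^1 space. *)
Lemma dist_foot x y : dist x y = foot_dist x y.
Proof.
apply/eqP; rewrite eq_le foot_dist_le andbT.
by apply: ge_inf; [exact: (has_inf_route x y).2|exact: route_foot].
Qed.

Lemma route_dist x y : route x (dist x y) y.
Proof. by rewrite dist_foot; exact: route_foot. Qed.

End cuts.

(** * Segments *)

Section segments.
Context {R : realType} {G : metricGraph R}.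
Hypothesis G_tree : acyclic G.
Implicit Types (e f : edge G) (x y z p q : gpoint G).

(** Two cuts of a tree never cross: the points beyond [e] as seen from [f] are
    all on the side of [f] containing [e].  A route from [src e] preserves the
    alternative, because on [e] and on [f] one of its branches holds, and
    elsewhere neither foot moves. *)
Lemma foot_crossing e f y : e != f ->
  foot e y = foot e (inl (src f)) \/ foot f y = foot f (inl (src e)).
Proof.
move=> ef; pose P z := foot e z = foot e (inl (src f)) \/
  foot f z = foot f (inl (src e)).
suff step x L z : route x L z -> P x -> P z.
  by have [L /step] := route_exists (inl (src e)) y; apply; right.
elim=> {x L z} // g s t M z hs ht _ IH sE; apply: IH; rewrite /P.
have [ge|ge] := eqVneq g e.
  by subst g; right; apply: foot_pt_neq.
have [gf|gf] := eqVneq g f.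
  by subst g; left; apply: foot_pt_neq; rewrite // eq_sym.
by rewrite -(@foot_pt_neq2 _ _ e g s t)// -(@foot_pt_neq2 _ _ f g s t).
Qed.

Definition seg x y p : Prop := dist x p + dist p y = dist x y.

Lemma seg_foot x y p : seg x y p <->
  forall e, `|foot e x - foot e p| + `|foot e p - foot e y| = `|foot e x - foot e y|.
Proof.
rewrite /seg !dist_foot// /foot_dist -big_split/=; split=> [|H]; last exact: eq_bigr.
move=> /eqP; rewrite -subr_eq0 -sumrB psumr_eq0 => [/allP H e|e _].
  by apply/eqP; rewrite -subr_eq0; exact: H (mem_index_enum e).
by rewrite subr_ge0 ler_distD.
Qed.

Lemma norm_betweenP (a b c : R) : `|a - b| + `|b - c| = `|a - c| <->
  (a <= b <= c) || (c <= b <= a).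
Proof.
by case: (lerP a b) => h1; case: (lerP b c) => h2; case: (lerP a c) => h3; split; lra.
Qed.

Lemma seg_coordP x y p : seg x y p <->
  forall e, (foot e x <= foot e p <= foot e y) || (foot e y <= foot e p <= foot e x).
Proof.
by rewrite seg_foot; split=> H e; apply/norm_betweenP; exact: H.
Qed.

(** A point [p] outside both other sides is missed by them in coordinates [e]
    and [f], distinct since thinness is clear on the line.  Then the feet of
    [p], [x], [y] and [z] on these two edges contradict [foot_crossing]. *)
Lemma seg_thin y x z p : seg x z p -> seg x y p \/ seg y z p.
Proof.
move=> /seg_coordP xz; apply: contrapT => /not_orP[/seg_coordP/existsNP[e he]].
move=> /seg_coordP/existsNP[f hf]; have he' := xz e; have hf' := xz f.
have [ef|ef] := eqVneq e f; first by subst f; lra.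
have c p' := @foot_crossing e f p' ef.
by case: (c p); case: (c x); case: (c y); case: (c z); lra.
Qed.

Lemma route_split x L y s : route x L y -> 0 <= s <= L ->
  exists p, route x s p /\ route p (L - s) y.
Proof.
move=> r; elim: r s => {x L y} [x s|e a b L y ha hb r IH s /andP[s0 sL]].
  move=> s0; have -> : s = 0 by lra.
  by exists x; rewrite subrr; split; exact: route_nil.
have [sab|sab] := lerP s `|a - b|; last first.
  have [|p [r1 r2]] := IH (s - `|a - b|); first lra.
  exists p; split; last by rewrite (_ : _ - s = L - (s - `|a - b|)) //; lra.
  rewrite (_ : s = `|a - b| + (s - `|a - b|)); last lra.
  exact: route_cons.
pose c := if a <= b then a + s else a - s.
have [hc ac cb] : [/\ 0 <= c <= len e, `|a - c| = s & `|c - b| = `|a - b| - s].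
  by rewrite /c; case: (lerP a b) sab => ab sab; split;
    do ?[case: ler0P => ?]; lra.
exists (pt e c); split; first by rewrite -ac; exact: route_seg.
by rewrite addrAC -cb; exact: route_cons.
Qed.

Lemma seg_point x y s : 0 <= s <= dist x y ->
  exists p, seg x y p /\ dist x p = s.
Proof.
move=> hs; have [p [r1 r2]] := route_split (route_dist G_tree x y) hs.
have le1 : dist x p <= s by apply: ge_inf => //; exact: (has_inf_route x p).2.
have le2 : dist p y <= dist x y - s.
  by apply: ge_inf => //; exact: (has_inf_route p y).2.
by have := dist_triangle p x y; exists p; rewrite /seg; lra.
Qed.

Lemma dist_ge0 x y : 0 <= dist x y.
Proof. by have := dist_triangle y x x; rewrite distxx (dist_sym y x); lra. Qed.

Lemma seg_isometry x y p q : seg x y p -> seg x y q ->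
  dist p q = `|dist x p - dist x q|.
Proof.
move=> hp hq; have := dist_ge0 p q; have := seg_thin q hp; move: hp hq; rewrite /seg.
rewrite (dist_sym q p); case: (lerP (dist x p) (dist x q)) => ? ? ? [] *; lra.
Qed.

(** The median of [x], [y] and [q] is found on the segment from [x] to [y] at
    the Gromov product of [y] and [q] seen from [x]; thinness puts it on one of
    the two other sides, and then its distances put it on both. *)
Lemma seg_median x y q : exists p, [/\ seg x y p, seg x q p & seg q y p].
Proof.
have h1 := dist_triangle x y q; have h2 := dist_triangle y x q.
have h3 := dist_triangle q x y; rewrite (dist_sym y x) (dist_sym q y) in h1 h3.
have [|p [hp ps]] := @seg_point x y ((dist x y + dist x q - dist y q) / 2); first lra.
have := seg_thin q hp; move: hp; rewrite /seg => hp thin; exists p.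
have := dist_sym q p; have := dist_sym q y.
by case: thin => h; split; lra.
Qed.

(** A point moving inside an edge changes only its foot on that edge, so that
    [u z - \sum_e u (pt e (foot e z))] does not depend on [z]. *)
Lemma telescope (u : gpoint G -> R) x y :
  \sum_e (u (pt e (foot e y)) - u (pt e (foot e x))) = u y - u x.
Proof.
pose F z := u z - \sum_e u (pt e (foot e z)).
suff : F x = F y.
  by rewrite sumrB /F; lra.
have [L] := route_exists x y; elim=> // e s t M z hs ht _ <-.
rewrite /F (bigD1 e)//= [in RHS](bigD1 e)//= !foot_pt// !opprD !addrA !subrr.
congr (_ - _); apply: eq_bigr => f fe.
by rewrite (@foot_pt_neq2 _ _ f e s t)// eq_sym.
Qed.

End segments.

(** * Simple paths and connected sets *)

Section paths.

Lemma connected_locally_constant (T : topologicalType) (C : set T) (P : T -> Prop) :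
  connected C -> (forall x, C x -> \forall y \near x, P x <-> P y) ->
  forall x y, C x -> C y -> P x -> P y.
Proof.
move=> cC lP x y Cx Cy Px; apply: contrapT => nPy; move: cC.
apply/connectedPn; exists (fun b => C `&` (if b then P else ~` P)); split.
- by case; [exists x|exists y].
- by rewrite -setIUr setvU setIT.
- split; apply/seteqP; split=> // z [].
  + move=> cz [Cz Pz]; have [w [[_ nPw] Pw]] := cz _ (lP z Cz).
    by apply: nPw; apply/Pw.
  + move=> [Cz nPz] cz; have [w [[_ Pw] Pz]] := cz _ (lP z Cz).
    by apply: nPz; apply/Pz.
Qed.

Context {R : realType} {G : metricGraph R}.
Hypothesis G_tree : acyclic G.
Implicit Types (x y z p q : gpoint G).

Lemma dist_gt0 x y : x <> y -> 0 < dist x y.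
Proof.
move=> xy; rewrite lt_neqAle dist_ge0 andbT eq_sym.
by apply/eqP => /dist_eq0.
Qed.

(** By thinness, [z] can only change sides of [p] by moving at least as far as
    [p]. *)
Lemma seg_locally_constant x p z : p <> z ->
  \forall z' \near z, seg x z p <-> seg x z' p.
Proof.
move=> /eqP; rewrite eq_sym => /eqP/dist_gt0 d0; near=> z'.
have : dist z z' < dist z p by near: z'; exact: (nbhsx_ballx z _ d0).
have := dist_ge0 z' p; have := dist_sym z z'; have := dist_sym z p.
move=> h1 h2 h3 h4; split=> [/(seg_thin G_tree z')|/(seg_thin G_tree z)] [] //;
  rewrite /seg; have := dist_sym z' p; lra.
Unshelve. all: by end_near. Qed.

Lemma connected_seg (C : set (gpoint G)) x y :
  connected C -> C x -> C y -> seg x y `<=` C.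
Proof.
move=> cC Cx Cy p xyp; apply: contrapT => nCp.
have : seg x x p.
  apply: (@connected_locally_constant _ C (seg x ^~ p) cC _ y x) => // z Cz.
  by apply: seg_locally_constant => pz; apply: nCp; rewrite pz.
rewrite /seg distxx (dist_sym p) => h; have := dist_ge0 x p.
by move=> h'; apply: nCp; rewrite -(@dist_eq0 _ _ x p)//; lra.
Qed.

Lemma path_seg (a b : R) (g : R -> gpoint G) : a <= b ->
  {within `[a, b], continuous g} -> seg (g a) (g b) `<=` g @` `[a, b].
Proof.
move=> ab cg; apply: connected_seg.
- exact: connected_continuous_connected (@segment_connected R a b) cg.
- by exists a => //=; rewrite in_itv/= lexx ab.
- by exists b => //=; rewrite in_itv/= lexx ab.
Qed.

Lemma simple_path_seg x y : x <> y -> simple_path x y (seg x y).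
Proof.
move=> /dist_gt0 l0.
pose g (s : R) := xget x [set p | seg x y p /\ dist x p = s * dist x y].
have gP s : `[0, 1]%classic s -> seg x y (g s) /\ dist x (g s) = s * dist x y.
  rewrite /= in_itv/= => /andP[s0 s1].
  have [|p hp] := @seg_point _ _ G_tree x y (s * dist x y).
    by rewrite mulr_ge0 ?(ltW l0)//= ler_piMl// ltW.
  exact: (@xgetPex _ x [set p | seg x y p /\ dist x p = s * dist x y] (ex_intro _ p hp)).
have gd s t : `[0, 1]%classic s -> `[0, 1]%classic t -> dist (g s) (g t) = `|s - t| * dist x y.
  move=> /gP[gs ds] /gP[gt dt]; rewrite (seg_isometry G_tree gs gt) ds dt.
  by rewrite -mulrBl normrM (gtr0_norm l0).
have m0 : `[0, 1]%classic (0 : R) by rewrite /= in_itv/= lexx ler01.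
have m1 : `[0, 1]%classic (1 : R) by rewrite /= in_itv/= lexx ler01.
exists g; split.
- apply/subspace_continuousP => s hs; apply/cvg_ballP => e e0.
  have el0 : 0 < e / dist x y by rewrite divr_gt0.
  apply: filterS (nbhsx_ballx s _ el0) => t st ht.
  rewrite /ball/= -/(dist _ _) gd//.
  by rewrite -ltr_pdivlMr.
- move=> s t /set_mem hs /set_mem ht gst; apply/eqP; rewrite -subr_eq0 -normr_eq0.
  have := gd _ _ hs ht; rewrite gst distxx => /esym/eqP.
  by rewrite mulf_eq0 (gt_eqF l0) orbF.
- by have [_] := gP _ m0; rewrite mul0r => /dist_eq0.
- have [h1] := gP _ m1; rewrite mul1r => h2; apply: dist_eq0.
  by move: h1; rewrite /seg h2; lra.
- apply/seteqP; split=> [p hp|_ [s hs <-]]; last by have [] := gP _ hs.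
  have hs : `[0, 1]%classic (dist x p / dist x y).
    rewrite /= in_itv/= divr_ge0 ?dist_ge0//= ler_pdivrMr// mul1r -hp.
    by rewrite lerDl dist_ge0.
  exists (dist x p / dist x y) => //; apply: dist_eq0.
  have [h1 h2] := gP _ hs; rewrite (seg_isometry G_tree h1 hp) h2.
  by rewrite divfK ?subrr ?normr0// gt_eqF.
Qed.

(** Before reaching any of its points [q] the path runs over the segment from
    [x] to [q], and after it over the segment from [q] to [y].  So it goes twice
    through the median of [x], [y] and [q]; being injective, it does so at [q],
    which then lies on the segment from [x] to [y]. *)
Lemma simple_path_unique x y U : simple_path x y U -> seg x y = U.
Proof.
move=> [g [cg ig <- <- ->]]; apply/seteqP; split; first exact: path_seg.
move=> _ [s /[dup] hs + <-]; rewrite /= in_itv/= => /andP[s0 s1].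
have [p [h1 h2 h3]] := seg_median G_tree (g 0) (g 1) (g s).
have sub (a b : R) : 0 <= a -> b <= 1 -> `[a, b] `<=` `[0, 1 : R].
  by move=> a0 b1 t /=; rewrite !in_itv/= => /andP[? ?]; apply/andP; split; lra.
have [a ha pa] : (g @` `[0, s]) p.
  by apply: path_seg h2 => //; apply: continuous_subspaceW cg; exact: sub.
have [b hb pb] : (g @` `[s, 1]) p.
  by apply: path_seg h3 => //; apply: continuous_subspaceW cg; exact: sub.
have ab : a = b.
  apply: ig; rewrite ?pa ?pb//; apply/mem_set.
  - exact: sub ha.
  - exact: sub hb.
subst b; rewrite (_ : s = a) ?pa//; move: ha hb; rewrite /= !in_itv/=; lra.
Qed.

(** A point [p] of the segment strictly between the projections of [z1] and
    [z2] would lie on the side of [y] of the one and of [x] of the other, which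
    is impossible within a connected set avoiding [p]. *)
Lemma off_seg_constant x y z1 z2 : connected_component (~` seg x y) z1 z2 ->
  dist x z1 - dist y z1 = dist x z2 - dist y z2.
Proof.
suff le w1 w2 : connected_component (~` seg x y) w1 w2 ->
    dist x w2 - dist y w2 <= dist x w1 - dist y w1.
  move=> h; apply/eqP; rewrite eq_le !le//.
  exact: connected_component_sym.
move=> [C [Cw1 CU cC] Cw2]; rewrite leNgt; apply/negP => w12.
(* The abscissa on the segment of the midpoint of the projections of [w1] and
   [w2], since [z] projects at [(dist x z - dist y z + dist x y) / 2]. *)
pose s := ((dist x w1 - dist y w1 + (dist x w2 - dist y w2)) / 2 + dist x y) / 2.
have [|p [xyp ps]] := @seg_point _ _ G_tree x y s.
  have := dist_triangle x y w1; have := dist_triangle y x w2.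
  have := dist_sym x y; rewrite /s.
  have := dist_triangle x y w2; have := dist_triangle y x w1; lra.
have nCp : ~ C p by move=> /CU.
have : seg x w1 p.
  apply: (@connected_locally_constant _ C (seg x ^~ p) cC _ w2 w1) => // [z Cz|].
    by apply: seg_locally_constant => pz; apply: nCp; rewrite pz.
  case: (seg_thin G_tree w2 xyp) => //; have := dist_triangle p x w2.
  have := dist_sym w2 y; have := dist_sym w2 p; have := dist_sym p y.
  by move: xyp ps; rewrite /seg /s; lra.
have := dist_triangle p y w1; have := dist_sym p y.
by move: xyp ps; rewrite /seg /s; lra.
Qed.

End paths.

(** * Steps of class C^1 *)

Section test_functions.
Context {R : realType}.
Implicit Types (a c d e l t : R).

Definition pos t : R := Num.max 0 t.

Lemma pos_eq0 t : t <= 0 -> pos t = 0. Proof. by move/max_idPl. Qed.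

Lemma pos_id t : 0 <= t -> pos t = t. Proof. by move/max_idPr. Qed.

Lemma continuous_pos_shift c : continuous (fun t => pos (t - c)).
Proof.
move=> t; apply: (@continuous_max _ _ (cst 0) (fun t => t - c)); first exact: cvg_cst.
by apply: cvgB; [exact: cvg_id|exact: cvg_cst].
Qed.

(** The derivative [pos] being 1-Lipschitz, the remainder is at most quadratic. *)
Lemma is_derive_pos_sqr c t :
  is_derive t 1 (fun s => pos (s - c) ^+ 2 / 2) (pos (t - c)).
Proof.
have cvg : h^-1 *: (pos (h *: 1 + t - c) ^+ 2 / 2 - pos (t - c) ^+ 2 / 2) @[h --> 0^'] -->
    pos (t - c).
  apply/cvgrPdist_le => e e0; near=> h.
  have h0 : h != 0 by near: h; exact: nbhs_dnbhs_neq.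
  have he : `|h| <= e.
    near: h; apply: dnbhs0_le => //.
  have : `|h * pos (t - c) - (pos (h *: 1 + t - c) ^+ 2 / 2 - pos (t - c) ^+ 2 / 2)|
      <= h ^+ 2.
    rewrite scaler1 /pos ler_norml; case: (lerP 0 (t - c)) => h1;
      case: (lerP 0 (h + t - c)) => h2; apply/andP; split; nra.
  have -> : pos (t - c) - h^-1 *: (pos (h *: 1 + t - c) ^+ 2 / 2 - pos (t - c) ^+ 2 / 2)
    = h^-1 * (h * pos (t - c) - (pos (h *: 1 + t - c) ^+ 2 / 2 - pos (t - c) ^+ 2 / 2)).
    by rewrite mulrBr mulKf.
  rewrite -[X in _ <= X]real_normK ?num_real// => hh; rewrite normrM normfV ler_pdivrMl ?normr_gt0//.
  by rewrite (le_trans hh)// expr2 ler_wpM2l.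
apply: DeriveDef; last exact: cvg_lim cvg.
by apply/cvg_ex; exists (pos (t - c)).
Unshelve. all: by end_near. Qed.

(** A second difference of the functions [pos (t - c) ^+ 2 / 2], which are of
    class C^1: it rises from 0 to 1 on [c, c + 2 d]. *)
Definition smooth_step c d t : R :=
  (pos (t - c) ^+ 2 / 2 - 2 * (pos (t - (c + d)) ^+ 2 / 2) +
   pos (t - (c + d + d)) ^+ 2 / 2) / d ^+ 2.

(** The corresponding second difference of [pos]: a tent of mass 1 on
    [c, c + 2 d]. *)
Definition tent c d t : R :=
  (pos (t - c) - 2 * pos (t - (c + d)) + pos (t - (c + d + d))) / d ^+ 2.

Lemma is_derive_smooth_step c d t : is_derive t 1 (smooth_step c d) (tent c d t).
Proof.
have h1 := is_derive_pos_sqr c t; have h2 := is_derive_pos_sqr (c + d) t.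
have h3 := is_derive_pos_sqr (c + d + d) t.
have := is_deriveZ ((d ^+ 2)^-1) (is_deriveD (is_deriveB h1 (is_deriveZ 2 h2)) h3).
have -> : ((d ^+ 2)^-1 \*: (((fun s : R => pos (s - c) ^+ 2 / 2) -
   2 \*: (fun s : R => pos (s - (c + d)) ^+ 2 / 2)) +
   (fun s : R => pos (s - (c + d + d)) ^+ 2 / 2)) = smooth_step c d)%R.
  by apply/funext => s; rewrite /smooth_step mulrC.
move=> h; apply: is_derive_eq h _; by rewrite /tent [RHS]mulrC.
Qed.

Lemma continuous_tent c d : continuous (tent c d).
Proof.
move=> t; apply: cvgM; last exact: cvg_cst.
apply: cvgD; last exact: continuous_pos_shift.
apply: cvgB; first exact: continuous_pos_shift.
by apply: cvgM; [exact: cvg_cst|exact: continuous_pos_shift].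
Qed.

Lemma tent_ge0 c d t : 0 < d -> 0 <= tent c d t.
Proof.
move=> d0; rewrite /tent divr_ge0 ?sqr_ge0//.
rewrite /pos; case: (lerP 0 (t - c)); case: (lerP 0 (t - (c + d)));
  case: (lerP 0 (t - (c + d + d))); lra.
Qed.

Lemma tent_eq0 c d t : 0 < d -> t <= c \/ c + d + d <= t -> tent c d t = 0.
Proof.
move=> d0 h; rewrite /tent; apply/eqP; rewrite mulf_eq0; apply/orP; left; apply/eqP.
rewrite /pos; case: (lerP 0 (t - c)); case: (lerP 0 (t - (c + d)));
  case: (lerP 0 (t - (c + d + d))); case: h; lra.
Qed.

Lemma smooth_step_eq0 c d t : 0 < d -> t <= c -> smooth_step c d t = 0.
Proof.
by move=> d0 h; rewrite /smooth_step !pos_eq0; lra.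
Qed.

Lemma smooth_step_eq1 c d t : 0 < d -> c + d + d <= t -> smooth_step c d t = 1.
Proof.
move=> d0 h; rewrite /smooth_step !pos_id; try lra.
rewrite (_ : _ + _ = d ^+ 2); last lra.
by rewrite divff// expf_neq0// gt_eqF.
Qed.

Lemma smooth_step_itv c d t : 0 < d -> 0 <= smooth_step c d t <= 1.
Proof.
move=> d0; have [tc|ct] := lerP t c; first by rewrite smooth_step_eq0// lexx ler01.
have [dt|td] := lerP (c + d + d) t; first by rewrite smooth_step_eq1// lexx ler01.
have d20 : 0 < d ^+ 2 by rewrite exprn_gt0.
rewrite /smooth_step ler_pdivlMr// ler_pdivrMr// mul0r mul1r.
rewrite (@pos_eq0 (t - (c + d + d))); last lra.
rewrite (@pos_id (t - c)); last lra.
have [tcd|ctd] := lerP t (c + d).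
  rewrite (@pos_eq0 (t - (c + d))); last lra.
  have : (t - c) ^+ 2 <= d ^+ 2 by rewrite lerXn2r ?nnegrE; lra.
  by have := sqr_ge0 (t - c); lra.
rewrite (@pos_id (t - (c + d))); last lra.
have : (c + d + d - t) ^+ 2 <= d ^+ 2 by rewrite lerXn2r ?nnegrE; lra.
by have := sqr_ge0 (c + d + d - t); lra.
Qed.

End test_functions.

(** * Integrals over a bounded interval *)

Section integrals.
Context {R : realType}.
Notation mu := (@lebesgue_measure R).
Implicit Types (a b c d l t : R) (f g h phi : R -> R).

Lemma continuous_integrable_oo a b f : continuous f ->
  mu.-integrable `]a, b[ (EFin \o f).
Proof.
move=> cf; apply: (@integrableS _ _ _ mu `[a, b]) => //.
  exact: subset_itv_oo_cc.
apply: continuous_compact_integrable; first exact: segment_compact.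
exact: continuous_subspaceT.
Qed.

Lemma bounded_Lfun2 l f (M : R) : measurable_fun `]0, l[ f ->
  (forall t, `]0, l[%classic t -> `|f t| <= M) ->
  f \_ `]0, l[ \in Lfun mu 2%:E.
Proof.
move=> mf fM.
have fin : (mu `]0%R, l[ < +oo)%E.
  by rewrite lebesgue_measure_itv/=; case: ifP; rewrite ?ltry// -EFinD ltry.
have mf' : measurable_fun setT (f \_ `]0, l[) by apply/(measurable_restrictT _ _).1.
rewrite inE; apply/andP; split; rewrite inE//=.
rewrite /finite_norm unlock /Lnorm poweR_lty//.
rewrite (_ : (\int[_]_x _)%E =
    (\int[mu]_t (((fun t => (`|f t| ^+ 2)%:E) \_ `]0%R, l[) t))%E); last first.
  apply: eq_integral => t _; rewrite /= powR_mulrn// !patchE.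
  by case: ifPn => // _; rewrite normr0 expr0n.
rewrite -integral_mkcond.
apply: integrable_lty => //; apply: measurable_bounded_integrable => //.
- by apply: measurable_funX; exact: measurableT_comp.
- exists (M ^+ 2); split; rewrite ?num_real// => x xM t /= ht.
  rewrite (le_trans _ (ltW xM))// ger0_norm ?exprn_ge0//.
  by rewrite lerXn2r ?nnegrE ?(le_trans _ (fM _ ht)) ?fM.
Qed.

Lemma continuous_Lfun2 l f : continuous f -> f \_ `]0, l[ \in Lfun mu 2%:E.
Proof.
move=> cf; have cf' : {within `[0, l], continuous f} by exact: continuous_subspaceT.
have [M [_ hM]] := compact_bounded (continuous_compact cf' (@segment_compact _ 0 l)).
apply: (@bounded_Lfun2 l f (M + 1)).
  by apply: measurable_funTS; exact: continuous_measurable_fun.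
move=> t ht; apply: hM; first by rewrite ltrDl.
by exists t => //; exact: subset_itv_oo_cc ht.
Qed.

Lemma Lfun2_mul_integrable l f g : f \_ `]0, l[ \in Lfun mu 2%:E ->
  g \_ `]0, l[ \in Lfun mu 2%:E ->
  mu.-integrable `]0, l[ (EFin \o (fun t => f t * g t)).
Proof.
move=> hf hg; have /Lfun1_integrable := Lfun2_mul_Lfun1 hf hg.
rewrite (_ : EFin \o _ = (EFin \o (fun t => f t * g t)) \_ `]0, l[).
  by move/integrable_restrict; rewrite setTI; apply.
apply/funext => t; rewrite /= !patchE; case: ifPn => // _.
by rewrite mul0r.
Qed.

Lemma Lfun2_integrable l g : g \_ `]0, l[ \in Lfun mu 2%:E ->
  mu.-integrable `]0, l[ (EFin \o g).
Proof.
move=> hg; have h1 : (cst 1 : R -> R) \_ `]0, l[ \in Lfun mu 2%:E.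
  by apply: continuous_Lfun2; exact: cst_continuous.
by apply: eq_integrable (Lfun2_mul_integrable h1 hg) => // t _; rewrite /= mul1r.
Qed.

Definition after a t : R := (a < t)%R%:R.

Lemma measurable_after a : measurable_fun setT (after a).
Proof.
rewrite (_ : after a = \1_(`]a, +oo[)) //.
apply/funext => t; rewrite /after indicE; congr (_ %:R); congr nat_of_bool.
by apply/idP/idP; rewrite ?inE/= ?in_itv/= ?andbT// => ?; apply/mem_set; rewrite /= in_itv/= andbT.
Qed.

Lemma after_Lfun2 l a : after a \_ `]0, l[ \in Lfun mu 2%:E.
Proof.
apply: (@bounded_Lfun2 _ _ 1); first by apply: measurable_funTS; exact: measurable_after.
by move=> t _; rewrite /after; case: (a < t); rewrite ?normr1 ?normr0.
Qed.

Lemma Rintegral_FTC2 f (F : R -> R) a b : a <= b -> continuous f ->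
  (forall t : R, is_derive t (1 : R) F (f t)) ->
  \int[mu]_(t in `[a, b]) f t = F b - F a.
Proof.
rewrite le_eqVlt => /predU1P[<-|ab] cf dF.
  by rewrite set_itv1 Rintegral_set1 subrr.
have cF : continuous F.
  by move=> t; apply: differentiable_continuous; apply/derivable1_diffP; apply: ex_derive.
rewrite /Rintegral (@continuous_FTC2 _ f F)//.
- exact: continuous_subspaceT.
- split; first by move=> t _; apply: ex_derive.
  + exact: cvg_at_right_filter (cF a).
  + exact: cvg_at_left_filter (cF b).
- by move=> t _; rewrite derive1E; apply: derive_val.
Qed.

Lemma Rintegral_oo_cc a b f : continuous f ->
  \int[mu]_(t in `]a, b[) f t = \int[mu]_(t in `[a, b]) f t.
Proof.
move=> cf; have icc : mu.-integrable `[a, b] (EFin \o f).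
  apply: continuous_compact_integrable; first exact: segment_compact.
  exact: continuous_subspaceT.
rewrite Rintegral_itv_bndo_bndc ?Rintegral_itv_obnd_cbnd//.
- by apply: integrableS icc => //; apply: subset_itvr; rewrite bnd_simp.
- exact: continuous_integrable_oo.
Qed.

Lemma tent_mass l c d : 0 < d -> 0 <= c -> c + d + d <= l ->
  \int[mu]_(t in `]0, l[) tent c d t = 1.
Proof.
move=> d0 c0 cl; rewrite Rintegral_oo_cc; last exact: continuous_tent.
rewrite (@Rintegral_FTC2 _ _ _ _ _ _ (is_derive_smooth_step c d)).
- by rewrite smooth_step_eq1// smooth_step_eq0// subr0.
- lra.
- exact: continuous_tent.
Qed.

(** The tent is a probability density supported in [c, c + 2 d]. *)
Lemma tent_approx l c d f (y eta : R) : continuous f -> 0 < d -> 0 <= c -> c + d + d <= l ->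
  (forall t, c <= t <= c + d + d -> `|f t - y| <= eta) ->
  `|\int[mu]_(t in `]0, l[) (f t * tent c d t) - y| <= eta.
Proof.
move=> cf d0 c0 cl fy.
have cft : continuous (fun t => f t * tent c d t).
  by move=> t; apply: cvgM; [exact: cf|exact: continuous_tent].
have cyt (z : R) : continuous (fun t => z * tent c d t).
  by move=> t; apply: cvgM; [exact: cvg_cst|exact: continuous_tent].
have cfyt : continuous (fun t => f t * tent c d t - y * tent c d t).
  by move=> t; apply: cvgB; [exact: cft|exact: cyt].
have int z : \int[mu]_(t in `]0, l[) (z * tent c d t) = z.
  rewrite RintegralZl ?tent_mass ?mulr1//.
  by apply: continuous_integrable_oo; exact: continuous_tent.
rewrite -[X in _ - X]int -[X in _ <= X]int -RintegralB//; try exact: continuous_integrable_oo.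
apply: le_trans; first by apply: le_normr_Rintegral => //; exact: continuous_integrable_oo.
apply: le_Rintegral => //.
- by apply: continuous_integrable_oo => t; apply: cvg_norm; exact: cfyt.
- exact: continuous_integrable_oo.
- move=> t _; rewrite -mulrBl normrM (ger0_norm (tent_ge0 c t d0)).
  have [/fy h|] := boolP (c <= t <= c + d + d); first by rewrite ler_wpM2r ?tent_ge0.
  rewrite negb_and -!ltNge => h; rewrite (@tent_eq0 _ c d t d0) ?mulr0//.
  by case/orP: h => /ltW; [left|right].
Qed.

End integrals.

(** * The fundamental theorem of calculus for weak derivatives *)

Section weak_derivatives.
Context {R : realType}.
Notation mu := (@lebesgue_measure R).
Implicit Types (a b c d l t : R) (f g h phi : R -> R).

(** For small [d], a C^1 function supported in [a + d, l - d] and equal to 1 on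
    [a + 3 d, l - 3 d]. *)
Definition cutoff l a d t : R :=
  smooth_step (a + d) d t - smooth_step (l - d - d - d) d t.

Lemma is_derive_cutoff l a d t : is_derive t 1 (cutoff l a d)
  (tent (a + d) d t - tent (l - d - d - d) d t).
Proof.
exact: is_deriveB (is_derive_smooth_step _ _ _) (is_derive_smooth_step _ _ _).
Qed.

Lemma derive1_cutoff l a d :
  derive1 (cutoff l a d) = fun t => tent (a + d) d t - tent (l - d - d - d) d t.
Proof.
apply/funext => t; rewrite derive1E; have h := is_derive_cutoff l a d t.
exact: derive_val.
Qed.

Lemma cutoff_support l a d : 0 < d -> 0 <= a -> a + 4 * d <= l ->
  closure [set t | cutoff l a d t != 0] `<=` `]0, l[.
Proof.
move=> d0 a0 al.
have sub : [set t | cutoff l a d t != 0] `<=` `[a + d, l - d].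
  move=> t /=; rewrite in_itv/=; apply: contraNT; rewrite negb_and -!ltNge /cutoff.
  case/orP => h; first by rewrite !smooth_step_eq0 ?subr0//; lra.
  by rewrite !smooth_step_eq1 ?subrr//; lra.
move=> t /(closure_subset sub)/(@interval_closed R (BLeft _) (BRight _) isT isT).
by rewrite /= !in_itv/= => /andP[? ?]; apply/andP; split; lra.
Qed.

Lemma cutoff_norm_le l a d t : 0 < d -> `|cutoff l a d t| <= 1.
Proof.
move=> d0; have := smooth_step_itv (a + d) t d0.
have := smooth_step_itv (l - d - d - d) t d0.
by rewrite /cutoff ler_norml => /andP[? ?] /andP[? ?]; apply/andP; split; lra.
Qed.

Lemma continuous_cutoff l a d : continuous (cutoff l a d).
Proof.
move=> t; apply: differentiable_continuous; apply/derivable1_diffP.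
by have h := is_derive_cutoff l a d t; apply: ex_derive.
Qed.

Lemma near_small_mesh (x e : R) : 0 < x -> 0 < e ->
  \forall n \near \oo, x / (n.+4)%:R < e.
Proof.
move=> x0 e0; near=> n; rewrite ltr_pdivrMr// mulrC -ltr_pdivrMr//.
apply: (@lt_trans _ _ n%:R); last by rewrite ltr_nat -{1}[n]addn0 -addn4 ltn_add2l.
by near: n; exact: nbhs_infty_gtr.
Unshelve. all: by end_near. Qed.

(** With 4 as offset, four meshes fit in [x] from the start, as [cutoff]
    requires. *)
Lemma near_mesh (P : R -> Prop) (x e : R) : 0 < x -> 0 < e ->
  (forall d, 0 < d < e -> 4 * d <= x -> P d) ->
  \forall n \near \oo, P (x / (n.+4)%:R).
Proof.
move=> x0 e0 HP; have := near_small_mesh x0 e0; apply: filterS => n hn.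
apply: HP; first by rewrite hn andbT divr_gt0.
rewrite mulrA ler_pdivrMr// mulrC ler_wpM2l ?(ltW x0)//.
by rewrite (ler_nat _ 4).
Qed.

(** The left-hand sides of the weak formulation against cutoffs converge to
    [f a - f l] because the derivative of a cutoff is a difference of two
    concentrating tents, the right-hand sides by dominated convergence. *)
Lemma weak_derivative_FTC l f g a : continuous f -> weak_derivative l f g ->
  0 <= a <= l -> \int[mu]_(t in `]0, l[) (after a t * g t) = f l - f a.
Proof.
move=> cf [g2 fg] /andP[a0]; rewrite le_eqVlt => /predU1P[->|al].
  rewrite subrr (@eq_Rintegral _ _ _ _ _ (cst 0)).
    by rewrite Rintegral_cst// mul0r.
  move=> t; rewrite inE/= in_itv/= => /andP[_ tl].
  by rewrite /after ltNge (ltW tl) mul0r.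
pose d n : R := (l - a) / (n.+4)%:R.
have la : 0 < l - a by rewrite subr_gt0.
have d0 n : 0 < d n by rewrite divr_gt0.
have d4 n : a + 4 * d n <= l.
  rewrite -lerBrDl /d mulrA ler_pdivrMr// mulrC ler_wpM2l ?(ltW la)//.
  by rewrite (ler_nat _ 4).
have intg : mu.-integrable `]0, l[ (EFin \o g) by exact: Lfun2_integrable.
have mg : measurable_fun `]0, l[ g by apply/measurable_EFinP; exact: measurable_int intg.
have cvg1 : \int[mu]_(t in `]0, l[) (cutoff l a (d n) t * g t) @[n --> \oo] -->
    \int[mu]_(t in `]0, l[) (after a t * g t).
  have mc h : measurable_fun setT h ->
      measurable_fun `]0, l[ (fun t => (h t * g t)%:E).
    move=> mh; apply/measurable_EFinP; apply: measurable_funM => //.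
    exact: measurable_funTS.
  have [|||||i1 _ i3] := @dominated_convergence _ _ _ mu `]0, l[ (measurable_itv _)
    (fun n t => (cutoff l a (d n) t * g t)%:E) (fun t => (after a t * g t)%:E)
    (fun t => (`|g t|)%:E).
  - move=> n; apply: mc; apply: continuous_measurable_fun.
    exact: continuous_cutoff.
  - by apply: mc; exact: measurable_after.
  - apply: aeW => t; rewrite /= in_itv/= => /andP[t0 tl].
    apply: cvg_near_cst.
    have [ta|at_] := lerP t a.
      apply: nearW => n; rewrite /after ltNge ta/= /cutoff.
      rewrite !smooth_step_eq0 ?subrr ?mul0r//.
        by have := d4 n; have := d0 n; lra.
      by have := d0 n; lra.
    have e0 : 0 < Num.min (t - a) (l - t) / 3.
      by rewrite divr_gt0// lt_min !subr_gt0 at_.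
    apply: (@near_mesh (fun r => (cutoff l a r t * g t)%:E = (after a t * g t)%:E) _ _ la e0).
    move=> e {}e0 _; have {e0} /andP[e0 ht] := e0.
    have {}ht : e < (t - a) / 3 /\ e < (l - t) / 3.
      by split; apply: lt_le_trans ht _; rewrite ler_pM2r// ge_min lexx ?orbT.
    rewrite /after at_ /cutoff smooth_step_eq1 ?smooth_step_eq0 ?subr0//; lra.
  - by move/integrable_norm : intg.
  - apply: aeW => t n _; rewrite /= lee_fin normrM ler_piMl//.
    exact: cutoff_norm_le.
  - suff h3 : (\int[mu]_(t in `]0%R, l[) (cutoff l a (d n) t * g t)%:E
        @[n --> \oo] --> (\int[mu]_(t in `]0, l[) (after a t * g t))%:E)%E.
      exact: fine_cvg h3.
    by rewrite fineK; [exact: i3|exact: integrable_fin_num].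
have XE n : \int[mu]_(t in `]0, l[) (cutoff l a (d n) t * g t) =
   \int[mu]_(t in `]0, l[) (f t * tent (l - d n - d n - d n) (d n) t) -
   \int[mu]_(t in `]0, l[) (f t * tent (a + d n) (d n) t).
  have cc : continuous (derive1 (cutoff l a (d n))).
    rewrite derive1_cutoff => t; apply: cvgB; exact: continuous_tent.
  have dc t : derivable (cutoff l a (d n)) t 1.
    by have h := is_derive_cutoff l a (d n) t; apply: ex_derive.
  have := fg (cutoff l a (d n)) dc cc (cutoff_support (d0 n) a0 (d4 n)).
  have cft (c : R) : continuous (fun t => f t * tent c (d n) t).
    by move=> t; apply: cvgM; [exact: cf|exact: continuous_tent].
  rewrite derive1_cutoff => H.
  have -> : \int[mu]_(t in `]0, l[) (cutoff l a (d n) t * g t) =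
      \int[mu]_(t in `]0, l[) (g t * cutoff l a (d n) t).
    by apply: eq_Rintegral => t _; rewrite mulrC.
  rewrite -[LHS]opprK -H -[RHS]opprB -RintegralB//; try exact: continuous_integrable_oo.
  by congr (- _); apply: eq_Rintegral => t _; rewrite mulrBr.
have near_f (x e : R) : 0 < e -> exists2 del, 0 < del &
    forall t, `|t - x| < del -> `|f t - f x| <= e.
  move=> e0; have /cvgrPdist_le/(_ _ e0)/nbhs_ballP[del /= del0 hd] := cf x.
  by exists del => // t tx; rewrite distrC; apply: hd; rewrite /ball/= distrC.
have cvg2 : \int[mu]_(t in `]0, l[) (f t * tent (l - d n - d n - d n) (d n) t)
    @[n --> \oo] --> f l.
  apply/cvgrPdist_le => e e0; have [del del0 hd] := near_f l e e0.
  have del3 : 0 < del / 3 by rewrite divr_gt0.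
  apply: (@near_mesh (fun r => `|f l - \int[mu]_(t in `]0, l[)
    (f t * tent (l - r - r - r) r t)| <= e) _ _ la del3) => r /andP[r0 rd] r4.
  rewrite distrC; apply: tent_approx => //; try lra.
  by move=> t /andP[? ?]; apply: hd; rewrite ltr_norml; apply/andP; split; lra.
have cvg3 : \int[mu]_(t in `]0, l[) (f t * tent (a + d n) (d n) t)
    @[n --> \oo] --> f a.
  apply/cvgrPdist_le => e e0; have [del del0 hd] := near_f a e e0.
  have del3 : 0 < del / 3 by rewrite divr_gt0.
  apply: (@near_mesh (fun r => `|f a - \int[mu]_(t in `]0, l[)
    (f t * tent (a + r) r t)| <= e) _ _ la del3) => r /andP[r0 rd] r4.
  rewrite distrC; apply: tent_approx => //; try lra.
  by move=> t /andP[? ?]; apply: hd; rewrite ltr_norml; apply/andP; split; lra.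
apply: (cvg_unique (@Rhausdorff R) cvg1).
suff -> : (fun n => \int[mu]_(t in `]0, l[) (cutoff l a (d n) t * g t)) =
  (fun n => \int[mu]_(t in `]0, l[) (f t * tent (l - d n - d n - d n) (d n) t) -
   \int[mu]_(t in `]0, l[) (f t * tent (a + d n) (d n) t)).
  exact: cvgB cvg2 cvg3.
by apply/funext => n; exact: XE.
Qed.

End weak_derivatives.

(** * Weak derivatives of ramps, and uniqueness *)

Section ramps.
Context {R : realType}.
Notation mu := (@lebesgue_measure R).
Implicit Types (a b c k l t : R) (f g h phi : R -> R).

Lemma Rintegral_after l a f : 0 <= a ->
  \int[mu]_(t in `]0, l[) (after a t * f t) = \int[mu]_(t in `]a, l[) f t.
Proof.
move=> a0; have -> : `]a, l[%classic = `]0, l[ `&` `]a, l[ :> set R.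
  apply/esym/setIidPr => t /=; rewrite !in_itv/= => /andP[? ->].
  by rewrite andbT (le_lt_trans a0).
rewrite Rintegral_mkcondr; apply: eq_Rintegral => t.
rewrite inE/= in_itv/= => /andP[_ tl]; rewrite patchE /after.
case: ifPn; first by move/set_mem; rewrite /= in_itv/= => /andP[-> _]; rewrite mul1r.
move=> /negP tal; case: ltP => at_; last by rewrite mul0r.
by exfalso; apply: tal; apply/mem_set; rewrite /= in_itv/= at_.
Qed.

Lemma continuous_Rintegral_after l a f : continuous f -> 0 <= a <= l ->
  \int[mu]_(t in `]0, l[) (after a t * f t) = \int[mu]_(t in `[a, l]) f t.
Proof. by move=> cf /andP[a0 _]; rewrite Rintegral_after// Rintegral_oo_cc. Qed.

(** Integration by parts on [a, l]: the boundary terms vanish, at [a] because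
    [pos (t - a)] does and at [l] because [phi] does. *)
Lemma weak_derivative_pos l a phi : 0 <= a <= l ->
  (forall t, derivable phi t 1) -> continuous (derive1 phi) -> phi l = 0 ->
  \int[mu]_(t in `]0, l[) (pos (t - a) * derive1 phi t) =
  - \int[mu]_(t in `]0, l[) (after a t * phi t).
Proof.
move=> /[dup] hal /andP[a0 al] dphi cphi' phil.
have cphi : continuous phi.
  by move=> t; apply: differentiable_continuous; apply/derivable1_diffP.
have cid' : continuous (fun t => t - a).
  by move=> t; apply: cvgB; [exact: cvg_id|exact: cvg_cst].
have cparts : continuous (fun t => (t - a) * derive1 phi t).
  by move=> t; apply: cvgM; [exact: cid'|exact: cphi'].
have -> : \int[mu]_(t in `]0, l[) (pos (t - a) * derive1 phi t) =
    \int[mu]_(t in `]0, l[) (after a t * ((t - a) * derive1 phi t)).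
  apply: eq_Rintegral => t _; rewrite /after.
  by case: ltP => ta; [rewrite pos_id ?mul1r//|rewrite pos_eq0 ?mul0r//]; lra.
rewrite !continuous_Rintegral_after//.
apply/eqP; rewrite -addr_eq0 -RintegralD//; last 2 first.
- apply: continuous_compact_integrable; first exact: segment_compact.
  exact: continuous_subspaceT.
- apply: continuous_compact_integrable; first exact: segment_compact.
  exact: continuous_subspaceT.
have dF t : is_derive t (1 : R) (fun s => (s - a) * phi s) ((t - a) * derive1 phi t + phi t).
  have h1 : is_derive t (1 : R) (fun s => s - a) (1 : R).
    have := is_deriveB (is_derive_id t (1 : R)) (is_derive_cst a t (1 : R)).
    by rewrite subr0.
  have h2 : is_derive t (1 : R) phi (derive1 phi t).
    by apply: DeriveDef; [exact: dphi|rewrite derive1E].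
  have := is_deriveM h1 h2; rewrite scaler1 => h.
  by apply: is_derive_eq h _.
rewrite (@Rintegral_FTC2 _ _ _ _ _ _ _ dF)//.
  by rewrite phil subrr mulr0 mul0r subr0.
by move=> t; apply: cvgD; [exact: cparts|exact: cphi].
Qed.

Lemma test_function_end l phi :
  closure [set t | phi t != 0] `<=` `]0, l[ -> phi 0 = 0 /\ phi l = 0.
Proof.
move=> sub; split; apply/eqP/negPn/negP => nz.
  by have := sub 0 (@subset_closure _ [set t | phi t != 0] 0 nz); rewrite /= in_itv/= ltxx.
by have := sub l (@subset_closure _ [set t | phi t != 0] l nz); rewrite /= in_itv/= ltxx andbF.
Qed.

(** Equal to [c] between [a] and [b] if [a <= b], and to [- c] if [b <= a]: no
    order is assumed, as an edge may be crossed in either direction. *)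
Definition step c a b t : R := c * (after a t - after b t).

Lemma measurable_step c a b : measurable_fun setT (step c a b).
Proof.
apply: measurable_funM; first exact: measurable_cst.
by apply: measurable_funB; exact: measurable_after.
Qed.

Lemma step_Lfun2 l c a b : step c a b \_ `]0, l[ \in Lfun mu 2%:E.
Proof.
apply: (@bounded_Lfun2 _ _ _ `|c|).
  by apply: measurable_funTS; exact: measurable_step.
move=> t _; rewrite /step normrM ler_piMr// /after.
by case: ltP => _; case: ltP => _; rewrite ?subrr ?subr0 ?sub0r ?normrN ?normr1 ?normr0.
Qed.

Lemma weak_derivative_ramp l c a b k f : 0 <= a <= l -> 0 <= b <= l ->
  (forall t, 0 <= t <= l -> f t = c * (pos (t - a) - pos (t - b)) + k) ->
  weak_derivative l f (step c a b).
Proof.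
move=> ha hb fE; split; first exact: step_Lfun2.
move=> phi dphi cphi' /test_function_end[phi0 phil].
have cphi : continuous phi.
  by move=> t; apply: differentiable_continuous; apply/derivable1_diffP.
have cpos (x : R) : continuous (fun t => pos (t - x) * derive1 phi t).
  by move=> t; apply: cvgM; [exact: continuous_pos_shift|exact: cphi'].
have iafter x : mu.-integrable `]0, l[ (EFin \o (fun t => after x t * phi t)).
  by apply: Lfun2_mul_integrable; [exact: after_Lfun2|exact: continuous_Lfun2].
have int0 : \int[mu]_(t in `]0, l[) derive1 phi t = 0.
  have [l0|l0] := lerP 0 l; last by move: ha; lra.
  have dphi' t : is_derive t (1 : R) phi (derive1 phi t).
    by apply: DeriveDef; [exact: dphi|rewrite derive1E].
  rewrite Rintegral_oo_cc// (@Rintegral_FTC2 _ _ _ _ _ _ _ dphi')//.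
  by rewrite phi0 phil subrr.
have -> : \int[mu]_(t in `]0, l[) (f t * derive1 phi t) =
    c * (\int[mu]_(t in `]0, l[) (pos (t - a) * derive1 phi t) -
         \int[mu]_(t in `]0, l[) (pos (t - b) * derive1 phi t)) +
    k * \int[mu]_(t in `]0, l[) derive1 phi t.
  rewrite -RintegralB//; try exact: continuous_integrable_oo.
  have cB : continuous (fun t => pos (t - a) * derive1 phi t - pos (t - b) * derive1 phi t).
    by move=> t; apply: cvgB; exact: cpos.
  have cZ (x : R) (h : R -> R) : continuous h -> continuous (fun t => x * h t).
    by move=> ch t; apply: cvgM; [exact: cvg_cst|exact: ch].
  rewrite -!RintegralZl//; try exact: continuous_integrable_oo.
  rewrite -RintegralD//; try (by apply: continuous_integrable_oo; exact: cZ).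
  apply: eq_Rintegral => t; rewrite inE/= in_itv/= => /andP[t0 tl].
  by rewrite fE; [lra|rewrite !ltW].
have -> : \int[mu]_(t in `]0, l[) (step c a b t * phi t) =
    c * (\int[mu]_(t in `]0, l[) (after a t * phi t) -
         \int[mu]_(t in `]0, l[) (after b t * phi t)).
  rewrite -RintegralB// -RintegralZl//.
    by apply: eq_Rintegral => t _; rewrite /step; lra.
  by apply: eq_integrable (integrableB _ (iafter a) (iafter b)).
rewrite (weak_derivative_pos ha dphi cphi' phil) (weak_derivative_pos hb dphi cphi' phil).
by rewrite int0 mulr0 addr0 -mulrN opprB opprK [in LHS]addrC.
Qed.

(** A fundamental theorem of calculus between [a] and [b], in either order. *)
Lemma Rintegral_mul_step l c a b f g : continuous f -> weak_derivative l f g ->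
  0 <= a <= l -> 0 <= b <= l ->
  \int[mu]_(t in `]0, l[) (g t * step c a b t) = c * (f b - f a).
Proof.
move=> cf fg ha hb.
have iafter x : mu.-integrable `]0, l[ (EFin \o (fun t => after x t * g t)).
  by apply: Lfun2_mul_integrable; [exact: after_Lfun2|exact: fg.1].
have -> : \int[mu]_(t in `]0, l[) (g t * step c a b t) =
    c * (\int[mu]_(t in `]0, l[) (after a t * g t) -
         \int[mu]_(t in `]0, l[) (after b t * g t)).
  rewrite -RintegralB// -RintegralZl//.
    by apply: eq_Rintegral => t _; rewrite /step; lra.
  by apply: eq_integrable (integrableB _ (iafter a) (iafter b)).
by rewrite !(weak_derivative_FTC cf fg)//; lra.
Qed.

(** The primitive of [h] vanishes, and by Lebesgue's differentiation theorem its
    derivative is [h] almost everywhere. *)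
Lemma Rintegral_after_eq0 l h : mu.-integrable `]0, l[ (EFin \o h) ->
  (forall a, 0 <= a <= l -> \int[mu]_(t in `]0, l[) (after a t * h t) = 0) ->
  {ae mu, forall t, `]0, l[%classic t -> h t = 0}.
Proof.
move=> ih h0; pose k := h \_ `]0, l[.
have ik : mu.-integrable setT (EFin \o k).
  by rewrite -restrict_EFin; apply/(integrable_restrict _ _ _ _).1 => //; rewrite setTI.
have lk : locally_integrable setT k by exact: integrable_locally.
pose F x := \int[mu]_(t in `]-oo, x]) k t.
have F0 x : 0 < x < l -> F x = 0.
  move=> /andP[x0 xl]; have e0 : 0 <= (0 : R) <= l by rewrite lexx (ltW (lt_trans x0 xl)).
  have ex : 0 <= x <= l by rewrite !ltW.
  have ia y : mu.-integrable `]0, l[ (EFin \o (fun t => after y t * h t)).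
    have : mu.-integrable `]0, l[ ((EFin \o after y) \* (EFin \o h))%E.
      apply: integrableMr => //.
        by apply: measurable_funTS; exact: measurable_after.
      exists 1; split; rewrite ?num_real// => z z1 t _ /=; apply: le_trans (ltW z1).
      by rewrite /after; case: ltP; rewrite ?normr1 ?normr0.
    by [].
  have := h0 0 e0; rewrite -[RHS](h0 x ex) => /eqP; rewrite -subr_eq0 -RintegralB// => /eqP <-.
  rewrite /F Rintegral_mkcond [RHS]Rintegral_mkcond.
  apply: eq_Rintegral => t _; rewrite /k !patchE.
  have [tx|xt] := lerP t x.
    rewrite mem_set; last by rewrite /= in_itv/=.
    case: ifPn => // /set_mem; rewrite /= in_itv/= => /andP[t0 _].
    by rewrite /after t0 ltNge tx/=; lra.
  rewrite memNset; last by rewrite /= in_itv/=; apply/negP; rewrite -ltNge.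
  case: ifPn => // /set_mem; rewrite /= in_itv/= => /andP[t0 _].
  by rewrite /after t0 xt subrr.
have : {ae mu, forall x, derivable F x 1 /\ derive1 F x = k x}.
  apply: FTC1Ny => // y; exact: integrableS ik.
apply: filterS; first exact: (ae_filter_ringOfSetsType mu).
move=> x [_ Fk] hx.
have -> : h x = k x by rewrite /k patchE mem_set.
rewrite -Fk derive1E.
have : \forall y \near x, F y = cst 0 y.
  have := hx; rewrite /= in_itv/= => xl.
  have : \forall y \near x, `]0, l[%classic y.
    by apply: open_nbhs_nbhs; split => //; exact: interval_open.
  by apply: filterS => y; rewrite /= in_itv/=; exact: F0.
by move=> /near_eq_derive ->; rewrite derive_cst.
Qed.

Lemma weak_derivative_unique l f g h : continuous f ->
  weak_derivative l f g -> weak_derivative l f h ->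
  {ae mu, forall t, `]0, l[%classic t -> g t = h t}.
Proof.
move=> cf fg fh; have ig := Lfun2_integrable fg.1; have ih := Lfun2_integrable fh.1.
have : {ae mu, forall t, `]0, l[%classic t -> g t - h t = 0}.
  apply: Rintegral_after_eq0.
    by apply: eq_integrable (integrableB _ ig ih).
  move=> a ha.
  have iafter (k : R -> R) : k \_ `]0, l[ \in Lfun mu 2%:E ->
      mu.-integrable `]0, l[ (EFin \o (fun t => after a t * k t)).
    by move=> k2; apply: Lfun2_mul_integrable => //; exact: after_Lfun2.
  have -> : \int[mu]_(t in `]0, l[) (after a t * (g t - h t)) =
      \int[mu]_(t in `]0, l[) (after a t * g t) -
      \int[mu]_(t in `]0, l[) (after a t * h t).
    rewrite -RintegralB//; [|exact: iafter fg.1|exact: iafter fh.1].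
    by apply: eq_Rintegral => t _; rewrite mulrBr.
  by rewrite !(weak_derivative_FTC cf)// subrr.
apply: filterS; first exact: (ae_filter_ringOfSetsType mu).
by move=> t gh /gh /eqP; rewrite subr_eq0 => /eqP.
Qed.

End ramps.

(** * Energy on a tree *)

Section energy_on_trees.
Context {R : realType} {G : metricGraph R}.
Notation mu := (@lebesgue_measure R).
Implicit Types (e : edge G) (x y z : gpoint G) (u v : gpoint G -> R).

Lemma Lfun2_energy (l : R) (g : R -> R) : g \_ `]0, l[ \in Lfun mu 2%:E ->
  (\int[mu]_(t in `]0%R, l[) (g t ^+ 2)%:E)%E =
  (\int[mu]_(t in `]0, l[) (g t * g t))%:E.
Proof.
by move=> g2; rewrite fineK//; apply: integrable_fin_num => //; exact: Lfun2_mul_integrable.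
Qed.

Lemma Lfun2_sub (l : R) (g h : R -> R) : g \_ `]0, l[ \in Lfun mu 2%:E ->
  h \_ `]0, l[ \in Lfun mu 2%:E ->
  (fun t => g t - h t) \_ `]0, l[ \in Lfun mu 2%:E.
Proof.
move=> g2 h2; have le12 : (1 <= 2%:E :> \bar R)%E by rewrite lee_fin ler1n.
rewrite (_ : _ \_ _ = g \_ `]0, l[ - h \_ `]0, l[).
  exact: (@rpredB _ (hoelder_Lfun__canonical__Algebra_ZmodClosed mu le12)).
apply/funext => t; rewrite !fctE /= !patchE; case: ifPn => // _.
by rewrite subr0.
Qed.

Lemma Lfun2_norm_eq0 (l : R) (h : R -> R) : h \_ `]0, l[ \in Lfun mu 2%:E ->
  \int[mu]_(t in `]0, l[) (h t * h t) = 0 ->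
  forall a, \int[mu]_(t in `]0, l[) (after a t * h t) = 0.
Proof.
move=> h2 h0 a.
have ihh := Lfun2_mul_integrable h2 h2; have ih := Lfun2_integrable h2.
have mh : measurable_fun `]0, l[ h by apply/measurable_EFinP; exact: measurable_int ih.
have : (\int[mu]_(t in `]0%R, l[) `|(h t * h t)%:E| = 0)%E.
  transitivity (\int[mu]_(t in `]0, l[) (h t * h t))%:E; last by rewrite h0.
  rewrite -Lfun2_energy//.
  by apply: eq_integral => t _; rewrite /= ger0_norm ?expr2// -expr2 sqr_ge0.
move/ae_eq_integral_abs => /(_ (measurable_itv _) (measurable_int _ ihh)) hae.
rewrite /Rintegral (@ae_eq_integral _ _ _ mu _ (cst 0%E))//.
- by rewrite integral0.
- apply/measurable_EFinP; apply: measurable_funM => //.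
  by apply: measurable_funTS; exact: measurable_after.
- apply: filterS hae => t ht /ht /= [] /eqP; rewrite mulf_eq0 orbb => /eqP ->.
  by rewrite mulr0.
Qed.

Lemma grad_weak_derivative (l : R) (f : R -> R) : H1_interval l f ->
  weak_derivative l f (grad l f).
Proof.
move=> [_ [g fg]].
exact: (@xgetPex _ (fun=> 0) [set g | weak_derivative l f g] (ex_intro _ g fg)).
Qed.

Lemma pt_le0 e (t : R) : t <= 0 -> pt e t = inl (src e).
Proof. by move=> t0; rewrite /pt insubF ?t0//= ltNge t0. Qed.

Lemma pt_ge_len e (t : R) : len e <= t -> pt e t = inl (tgt e).
Proof.
move=> t0; rewrite /pt insubF /=; last by rewrite (ltNge t) t0 andbF.
by rewrite leNgt (lt_le_trans (len_gt0 e)).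
Qed.

(** Beyond the ends of the edge [pt e] is constant, so that both parameters may
    be clamped. *)
Lemma dist_pt_le e (s t : R) : dist (pt e s) (pt e t) <= `|s - t|.
Proof.
have l0 := len_gt0 e.
pose clamp r : R := if r <= 0 then 0 else if len e <= r then len e else r.
have clampP r : pt e r = pt e (clamp r) /\ 0 <= clamp r <= len e.
  rewrite /clamp; case: lerP => [r0|r0]; first by rewrite pt_le0// pt_src; split=> //; lra.
  case: lerP => [rl|rl]; first by rewrite pt_ge_len// pt_tgt; split=> //; lra.
  by split=> //; lra.
have [-> hs] := clampP s; have [-> ht] := clampP t.
apply: (@le_trans _ _ `|clamp s - clamp t|).
  by apply: ge_inf; [exact: (has_inf_route _ _).2|exact: route_seg].
rewrite ler_norml /clamp.
case: (lerP s t) => st; case: (lerP s 0) => s0; case: (lerP t 0) => t0;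
  case: (lerP (len e) s) => sl; case: (lerP (len e) t) => tl; lra.
Qed.

Lemma continuous_pt e : continuous (@pt R G e).
Proof.
move=> t; apply/cvg_ballP => r r0.
apply: filterS (nbhsx_ballx t _ r0) => s; rewrite /ball/= -/(dist _ _).
exact: le_lt_trans (dist_pt_le e t s).
Qed.

Lemma continuous_edge u e : continuous u -> continuous (fun t => u (pt e t)).
Proof. by move=> cu t; apply: continuous_comp; [exact: continuous_pt|exact: cu]. Qed.

(** The segment from [x] to [y] being parametrized affinely by [-1, 1], this is
    the parameter of the projection of [z] to it: the projection is at distance
    [(dist x z - dist y z + dist x y) / 2] of [x]. *)
Definition potential x y z : R := (dist x z - dist y z) / dist x y.

Lemma continuous_dist x : continuous (dist x).
Proof.
move=> z; apply/(@cvgrPdist_lt _ _ _ (nbhs z) (nbhs_filter z)) => r r0.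
apply: filterS (nbhsx_ballx z _ r0) => w; rewrite /ball/= -/(dist _ _) => zw.
have := dist_triangle z x w; have := dist_triangle w x z; rewrite (dist_sym w z) => *.
by rewrite ltr_norml; apply/andP; split; lra.
Qed.

Lemma continuous_potential x y : continuous (potential x y).
Proof.
have -> : potential x y = (dist x \- dist y) \* cst (dist x y)^-1 by [].
move=> z; apply: continuousM; last exact: cst_continuous.
by apply: continuousB; exact: continuous_dist.
Qed.

Lemma potential_src x y : x <> y -> potential x y x = - 1.
Proof.
move=> /dist_gt0 l0; rewrite /potential distxx (dist_sym y x) sub0r mulNr divff//.
by rewrite gt_eqF.
Qed.

Lemma potential_tgt x y : x <> y -> potential x y y = 1.
Proof. by move=> /dist_gt0 l0; rewrite /potential distxx subr0 divff// gt_eqF. Qed.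

Hypothesis G_tree : acyclic G.

(** On [e] the distance to [x] is [`|t - foot e x|] up to a constant, and
    [`|t - a|] is [2 * pos (t - a) - t + a], whose term in [t] is cancelled by
    that of the distance to [y]. *)
Lemma potential_edge x y e (t : R) : 0 <= t <= len e ->
  potential x y (pt e t) =
  2 / dist x y * (pos (t - foot e x) - pos (t - foot e y)) + potential x y (pt e 0).
Proof.
move=> ht; have h0 : 0 <= (0 : R) <= len e by rewrite lexx ltW ?len_gt0.
have dE z : dist z (pt e t) = dist z (pt e 0) + 2 * pos (t - foot e z) - t.
  have := foot_dist_pt G_tree z ht h0; rewrite -!dist_foot// !(dist_sym z).
  have := foot_range e z; rewrite /pos.
  by case: (lerP 0 (t - foot e z)) => h1 /andP[h2 h3];
    case: (lerP t (foot e z)) => h4; case: (lerP 0 (foot e z)) => h5; lra.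
by rewrite /potential !dE; lra.
Qed.

Lemma potential_weak_derivative x y e :
  weak_derivative (len e) (fun t => potential x y (pt e t))
    (step (2 / dist x y) (foot e x) (foot e y)).
Proof.
apply: weak_derivative_ramp; try exact: foot_range.
by move=> t ht; exact: potential_edge.
Qed.

Lemma potential_admissible x y : x <> y -> admissible (potential x y).
Proof.
move=> xy; have l0 := dist_gt0 xy; split.
- split; first exact: continuous_potential.
  move=> e; split; last by exists (step (2 / dist x y) (foot e x) (foot e y));
    exact: potential_weak_derivative.
  by apply: continuous_Lfun2; apply: continuous_edge; exact: continuous_potential.
- split; first by exists y => //; exact: potential_tgt.
  move=> _ [z _ <-]; rewrite /potential ler_pdivrMr// mul1r.
  by have := dist_triangle y x z; lra.
- split; first by exists x => //; exact: potential_src.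
  move=> _ [z _ <-]; rewrite /potential ler_pdivlMr// mulN1r.
  by have := dist_triangle x y z; rewrite (dist_sym y x); lra.
Qed.

(** The potential represents the linear form [u y - u x] for the Dirichlet
    inner product: on each edge the integral is the increment of [u] between the
    feet of [x] and [y], and these increments telescope. *)
Lemma potential_pairing x y u (g : edge G -> R -> R) : continuous u ->
  (forall e, weak_derivative (len e) (fun t => u (pt e t)) (g e)) ->
  \sum_e \int[mu]_(t in `]0, len e[)
     (g e t * step (2 / dist x y) (foot e x) (foot e y) t) =
  2 / dist x y * (u y - u x).
Proof.
move=> cu ug; rewrite -(telescope G_tree u x y) mulr_sumr; apply: eq_bigr => e _.
rewrite (Rintegral_mul_step _ (continuous_edge cu) (ug e)) ?foot_range//.
Qed.

Lemma energy_potential x y : x <> y -> energy (potential x y) = (4 / dist x y)%:E.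
Proof.
move=> xy; have [[cw Hw] _ _] := potential_admissible xy.
pose s e := step (2 / dist x y) (foot e x) (foot e y).
have -> : energy (potential x y) = (\sum_e \int[mu]_(t in `]0, len e[) (s e t * s e t))%:E.
  rewrite -sumEFin; apply: eq_bigr => e _.
  rewrite -Lfun2_energy; last exact: step_Lfun2.
  have hg := grad_weak_derivative (Hw e).
  have hs := potential_weak_derivative x y e.
  have mg := measurable_int _ (Lfun2_mul_integrable hg.1 hg.1).
  have ms := measurable_int _ (Lfun2_mul_integrable hs.1 hs.1).
  apply: ae_eq_integral => //.
  have := weak_derivative_unique (continuous_edge cw) hg hs.
  apply: filterS; first exact: (ae_filter_ringOfSetsType mu).
  by move=> t gs /gs ->.
rewrite (@potential_pairing x y _ s cw); last exact: potential_weak_derivative.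
by rewrite potential_src// potential_tgt//; congr (_%:E); lra.
Qed.

(** By [potential_pairing] the derivative of [v - potential x y] is orthogonal
    to that of the potential, hence by Pythagoras its energy is
    [energy v - 4 / dist x y], which is nonpositive. *)
Lemma le_energy_potential x y v : x <> y -> H1 v -> v x = - 1 -> v y = 1 ->
  (energy v <= (4 / dist x y)%:E)%E -> v = potential x y.
Proof.
move=> xy [cv Hv] vx vy Ev; have [[cw Hw] _ _] := potential_admissible xy.
pose c := 2 / dist x y.
pose s e := step c (foot e x) (foot e y).
pose g e := grad (len e) (fun t => v (pt e t)).
have hg e : weak_derivative (len e) (fun t => v (pt e t)) (g e).
  exact: grad_weak_derivative.
have hs e : weak_derivative (len e) (fun t => potential x y (pt e t)) (s e).
  exact: potential_weak_derivative.
have hgs e : (fun t => g e t - s e t) \_ `]0, len e[ \in Lfun mu 2%:E.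
  exact: Lfun2_sub (hg e).1 (hs e).1.
have igg e := Lfun2_mul_integrable (hg e).1 (hg e).1.
have igs e := Lfun2_mul_integrable (hg e).1 (hs e).1.
have iss e := Lfun2_mul_integrable (hs e).1 (hs e).1.
(* The square is expanded so that each integral is an energy or a pairing
   with [s]. *)
have sqrE e : \int[mu]_(t in `]0, len e[) ((g e t - s e t) * (g e t - s e t)) =
    \int[mu]_(t in `]0, len e[) (g e t * g e t) -
    \int[mu]_(t in `]0, len e[) (g e t * s e t) -
    (\int[mu]_(t in `]0, len e[) (g e t * s e t) -
     \int[mu]_(t in `]0, len e[) (s e t * s e t)).
  rewrite -[X in X - _]RintegralB// -[X in _ - X]RintegralB// -RintegralB//.
  - by apply: eq_Rintegral => t _; ring.
  - by apply: eq_integrable (integrableB _ (igg e) (igs e)).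
  - by apply: eq_integrable (integrableB _ (igs e) (iss e)).
have Es : \sum_e \int[mu]_(t in `]0, len e[) (g e t * g e t) <= 2 * c.
  rewrite -lee_fin (le_trans _ (le_trans Ev _))//.
    rewrite -sumEFin le_eqVlt; apply/orP; left; apply/eqP; apply: eq_bigr => e _.
    by rewrite -Lfun2_energy//; exact: (hg e).1.
  by rewrite lee_fin /c; lra.
have sum0 : \sum_e \int[mu]_(t in `]0, len e[) ((g e t - s e t) * (g e t - s e t)) <= 0.
  rewrite (eq_bigr _ (fun e _ => sqrE e)) !sumrB.
  rewrite (potential_pairing x y cv hg) (potential_pairing x y cw hs).
  by rewrite vx vy potential_src// potential_tgt// -/c; lra.
have int0 e : \int[mu]_(t in `]0, len e[) ((g e t - s e t) * (g e t - s e t)) = 0.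
  have ge0 f : 0 <= \int[mu]_(t in `]0, len f[) ((g f t - s f t) * (g f t - s f t)).
    by apply: Rintegral_ge0 => t _; rewrite -expr2 sqr_ge0.
  have /eqP := @le_anti _ R _ 0 (introT andP (conj sum0 (sumr_ge0 _ (fun f _ => ge0 f)))).
  by rewrite psumr_eq0// => /allP/(_ e (mem_index_enum e))/eqP.
(* [v - potential x y] has zero derivative on each edge, hence is constant by
   [telescope]. *)
pose d z := v z - potential x y z.
have d_end e a : 0 <= a <= len e -> d (pt e a) = d (pt e (len e)).
  move=> ha; have := Lfun2_norm_eq0 (hgs e) (int0 e) a.
  have -> : \int[mu]_(t in `]0, len e[) (after a t * (g e t - s e t)) =
     \int[mu]_(t in `]0, len e[) (after a t * g e t) -
     \int[mu]_(t in `]0, len e[) (after a t * s e t).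
    rewrite -RintegralB//.
    - by apply: eq_Rintegral => t _; rewrite mulrBr.
    - by apply: Lfun2_mul_integrable; [exact: after_Lfun2|exact: (hg e).1].
    - by apply: Lfun2_mul_integrable; [exact: after_Lfun2|exact: (hs e).1].
  rewrite (weak_derivative_FTC (continuous_edge cv) (hg e) ha).
  rewrite (weak_derivative_FTC (continuous_edge cw) (hs e) ha).
  by rewrite /d; lra.
apply/funext => z; have := telescope G_tree d x z.
rewrite big1 => [|e _]; last by rewrite !d_end ?foot_range// subrr.
by rewrite /d vx potential_src//; lra.
Qed.

End energy_on_trees.

Theorem proposition14 (R : realType) (G : metricGraph R) (v : gpoint G -> R)
    (xp xm : gpoint G) :
  acyclic G -> minimizer v -> v xp = 1 -> v xm = - 1 ->
  is_max [set dist x y | x in [set: gpoint G] & y in [set: gpoint G]]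
    (dist xm xp) /\
  exists U : set (gpoint G),
    [/\ unique (simple_path xm xp) U,
        forall x, U x -> v x = - 1 + 2 * dist xm x / dist xm xp &
        forall x y, (~` U) x -> connected_component (~` U) x y -> v y = v x].
Proof.
move=> G_tree [v_adm Ev] vp vm; have [Hv _ _] := v_adm.
have mp : xm <> xp by move=> E; move: vp; rewrite -E vm; lra.
have le_S (x y : gpoint G) : x <> y -> (energy v <= (4 / dist x y)%:E)%E.
  move=> xy; rewrite Ev -energy_potential// /S_inftyN; apply: ereal_inf_lbound.
  by exists (potential x y) => //; exact: potential_admissible.
have vE := le_energy_potential G_tree mp Hv vm vp (le_S _ _ mp).
have l0 := dist_gt0 mp; split.
  split; first by exists xm => //; exists xp.
  move=> _ [x _ [y _ <-]]; have [->|/eqP xy] := eqVneq x y.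
    by rewrite distxx ltW.
  have := le_S _ _ xy; rewrite vE energy_potential// lee_fin ler_pM2l// lef_pV2//.
  by rewrite posrE dist_gt0.
exists (seg xm xp); split.
- split; first exact: simple_path_seg.
  by move=> U; exact: simple_path_unique.
- move=> x hx; rewrite vE /potential (dist_sym xp) -hx; move: l0; rewrite -hx => l0.
  by field; rewrite gt_eqF.
- by move=> x y _ /(off_seg_constant G_tree) xy; rewrite vE /potential xy.
Qed.
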